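(* Let $X\in\mathfrak{X}^1(\mathbb{S}^6)$ be a vector field. Then $X$ solves the Hamilton-de Donder-Weyl equation on $(\mathbb{S}^6,\omega)$, i.e. there exists $\alpha\in\Omega^1(\mathbb{S}^6)$ with $\iota_X\omega=d\alpha$, if and only if $X=X_\xi$ for some $\xi\in\mathfrak{g}_2$.
   Context: The octonions $\mathbb{O}$ are the real algebra with vector space basis $e_0,e_1,\dots,e_7$, unit $e_0=1$, and products $e_ie_j=-\delta_{ij}+\sum_{k=1}^7\epsilon_{ijk}e_k$ for $i,j\in\{1,\dots,7\}$, where $\epsilon_{ijk}$ is completely antisymmetric, equal to $1$ for $ijk=123,145,167,246,275,374,365$, and $0$ whenever $(i,j,k)$ is not a permutation of one of these triples. The imaginary octonions (span of $e_1,\dots,e_7$) are identified with $\mathbb{R}^7$ with its standard scalar product $\langle\cdot,\cdot\rangle$. The cross product on $\mathbb{R}^7$ is $u\times v:=\frac12(u\cdot v-v\cdot u)$. The constant-coefficient $3$-form $\widetilde\omega$ on $\mathbb{R}^7$ is $\widetilde\omega(u,v,w)=\langle u\times v,w\rangle$. Let $j:\mathbb{S}^6\hookrightarrow\mathbb{R}^7$ be the inclusion of the unit sphere and $\omega:=j^*\widetilde\omega\in\Omega^3(\mathbb{S}^6)$. $G_2\subset GL(7,\mathbb{R})$ is the image of the group of $\mathbb{R}$-algebra automorphisms of $\mathbb{O}$ under restriction to the imaginary octonions $\mathbb{R}^7$; it is a closed subgroup of $SO(7,\mathbb{R})$ and acts on $\mathbb{S}^6$. Its Lie algebra is $\mathfrak{g}_2$,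 and $X_\xi$ denotes the fundamental vector field on $\mathbb{S}^6$ of $\xi\in\mathfrak{g}_2$, $X_\xi(p)=\frac{d}{dt}\big|_{t=0}e^{t\xi}\cdot p$. On an $n$-plectic manifold $(M,\omega)$ a couple $(H,X)\in\Omega^{n-k}(M)\times\mathfrak{X}^k(M)$ (with $\mathfrak{X}^k$ the $k$-vector fields) solves the Hamilton-de Donder-Weyl (HDW) equation in dimension $k$ if $\iota_X\omega=(-1)^{n+1-k}dH$; here $n=2$, $k=1$, so the equation is $\iota_X\omega=dH$. *)

(* Defs.v *)
From HB Require Import structures.
From mathcomp Require Import all_boot all_order all_algebra.
From mathcomp Require Import all_classical all_reals all_analysis.

Set Implicit Arguments.
Unset Strict Implicit.
Unset Printing Implicit Defensive.

Import Order.TTheory GRing.Theory Num.Theory.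
Import numFieldNormedType.Exports.

Local Open Scope classical_set_scope.
Local Open Scope ring_scope.

(* Vectors are columns, so that matrices act by left multiplication. *)
Definition dot (R : realType) (n : nat) (u v : 'cV[R]_n) : R :=
  \sum_(i < n) u i 0 * v i 0.

Definition fano : seq (nat * nat * nat) :=
  [:: (1, 2, 3); (1, 4, 5); (1, 6, 7); (2, 4, 6);
      (2, 7, 5); (3, 7, 4); (3, 6, 5)]%N.

Definition fano_cyclic (i j k : nat) : bool :=
  [|| (i, j, k) \in fano, (j, k, i) \in fano | (k, i, j) \in fano].

Definition epsilon (i j k : nat) : int :=
  if fano_cyclic i j k then 1 else if fano_cyclic j i k then -1 else 0.

Definition octonion (R : realType) := 'cV[R]_(1 + 7).

Definition oct_e (R : realType) (i : 'I_8) : octonion R := delta_mx i 0.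

Definition oct_e_mul (R : realType) (i j : 'I_8) : octonion R :=
  if i == ord0 then oct_e R j else
  if j == ord0 then oct_e R i else
  - ((i == j)%:R *: oct_e R ord0)
  + \sum_(k < 8 | k != ord0) (epsilon i j k)%:~R *: oct_e R k.

Definition oct_mul (R : realType) (x y : octonion R) : octonion R :=
  \sum_(i < 8) \sum_(j < 8) (x i 0 * y j 0) *: oct_e_mul R i j.

(* R^7 is the imaginary part: the coordinate of index i : 'I_7 is the
   coefficient of e_(i+1). *)
Definition im_oct (R : realType) (u : 'cV[R]_7) : octonion R := col_mx 0 u.

Definition cross (R : realType) (u v : 'cV[R]_7) : 'cV[R]_7 :=
  dsubmx (2^-1 *: (oct_mul (im_oct u) (im_oct v)
                   - oct_mul (im_oct v) (im_oct u)) : octonion R).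

Definition oct_automorphism (R : realType)
    (f : {linear octonion R -> octonion R}) : Prop :=
  [/\ bijective f, f (oct_e R ord0) = oct_e R ord0
    & forall x y : octonion R, f (oct_mul x y) = oct_mul (f x) (f y)].

Definition G2 (R : realType) : set 'M[R]_7 :=
  [set g | exists f : {linear octonion R -> octonion R},
     oct_automorphism f /\
     forall u : 'cV[R]_7, f (im_oct u) = im_oct (g *m u)].

Definition expmx (R : realType) (a : 'M[R]_7) : 'M[R]_7 :=
  limn (series (fun k : nat => (k`!%:R : R)^-1 *: a ^+ k)).

(* The Lie algebra of the closed matrix group G_2. *)
Definition g2 (R : realType) : set 'M[R]_7 :=
  [set xi | forall t : R, G2 (expmx (t *: xi))].

Definition fundamental_field (R : realType) (xi : 'M[R]_7) (p : 'cV[R]_7) :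
    'cV[R]_7 :=
  derive1 (fun t : R => expmx (t *: xi) *m p) 0.

(* On a finite-dimensional V this is the usual class C^k. *)
Fixpoint Ck (R : realType) (V W : normedModType R) (k : nat) (f : V -> W) :
    Prop :=
  if k is k'.+1 then
    (forall x, differentiable f x) /\ (forall v, Ck k' (fun x => 'D_v f x))
  else continuous f.

Definition smooth (R : realType) (V W : normedModType R) (f : V -> W) : Prop :=
  forall k, Ck k f.

Definition sphere6 (R : realType) : set 'cV[R]_7 := [set p | dot p p = 1].

Definition tangent_sphere (R : realType) (p : 'cV[R]_7) : set 'cV[R]_7 :=
  [set u | dot p u = 0].

(* Inverses R^6 -> S^6 of the stereographic projections from the poles
   (0, 1) (s = false) and (0, -1) (s = true); they form an atlas of S^6. *)
Definition stereo (R : realType) (s : bool) (y : 'cV[R]_6) : 'cV[R]_7 :=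
  (1 + dot y y)^-1 *:
    (col_mx (2 *: y) (((-1) ^+ s * (dot y y - 1))%:M : 'cV[R]_1)
       : 'cV[R]_(6 + 1)).

(* Vector fields and forms on S^6 are encoded by functions on all of R^7, of
   which only the values at points of S^6 and, for forms, on tangent vectors
   are meaningful. *)

Definition is_vector_field (R : realType) (X : 'cV[R]_7 -> 'cV[R]_7) : Prop :=
  (forall p, sphere6 p -> tangent_sphere p (X p)) /\
  (forall s : bool, exists xi : 'cV[R]_6 -> 'cV[R]_6, smooth xi /\
     forall y, X (stereo s y) = 'D_(xi y) (stereo s) y).

Definition pullback1 (R : realType) (f : 'cV[R]_6 -> 'cV[R]_7)
    (a : 'cV[R]_7 -> 'cV[R]_7 -> R) (y u : 'cV[R]_6) : R :=
  a (f y) ('D_u f y).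

Definition pullback2 (R : realType) (f : 'cV[R]_6 -> 'cV[R]_7)
    (b : 'cV[R]_7 -> 'cV[R]_7 -> 'cV[R]_7 -> R) (y u v : 'cV[R]_6) : R :=
  b (f y) ('D_u f y) ('D_v f y).

Definition is_oneform (R : realType) (a : 'cV[R]_7 -> 'cV[R]_7 -> R) : Prop :=
  (forall p, sphere6 p -> forall (c : R) (u v : 'cV[R]_7),
     tangent_sphere p u -> tangent_sphere p v ->
     a p (c *: u + v) = c * a p u + a p v) /\
  (forall (s : bool) (u : 'cV[R]_6),
     smooth (fun y => pullback1 (stereo s) a y u : R^o)).

Definition ext_d1 (R : realType) (a : 'cV[R]_6 -> 'cV[R]_6 -> R)
    (y u v : 'cV[R]_6) : R :=
  'D_u (fun z => a z v : R^o) y - 'D_v (fun z => a z u : R^o) y.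

(* b = da, expressed in both charts. *)
Definition is_ext_d (R : realType) (a : 'cV[R]_7 -> 'cV[R]_7 -> R)
    (b : 'cV[R]_7 -> 'cV[R]_7 -> 'cV[R]_7 -> R) : Prop :=
  forall (s : bool) (y u v : 'cV[R]_6),
    pullback2 (stereo s) b y u v = ext_d1 (pullback1 (stereo s) a) y u v.

Definition omega_tilde (R : realType) (u v w : 'cV[R]_7) : R :=
  dot (cross u v) w.

(* The differential of the inclusion of S^6 is the inclusion of tangent spaces,
   so in the above encoding the pullback is given by the same formula. *)
Definition omega (R : realType) (p u v w : 'cV[R]_7) : R := omega_tilde u v w.

Definition contraction (R : realType) (X : 'cV[R]_7 -> 'cV[R]_7)
    (eta : 'cV[R]_7 -> 'cV[R]_7 -> 'cV[R]_7 -> 'cV[R]_7 -> R)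
    (p u v : 'cV[R]_7) : R :=
  eta p (X p) u v.

Definition solves_HDW (R : realType) (X : 'cV[R]_7 -> 'cV[R]_7) : Prop :=
  exists a : 'cV[R]_7 -> 'cV[R]_7 -> R,
    is_oneform a /\ is_ext_d a (contraction X (@omega R)).

(* Main.v *)
Require Import Defs.
From mathcomp Require Import all_boot all_order all_algebra.
From mathcomp Require Import all_classical all_reals all_analysis.
From mathcomp Require Import ring lra.

(** Write phi for the 3-form omega_tilde and J for the operator u |-> p x u on
the tangent space of the sphere at p. Let psi be the alternating 4-form
psi(a,b,c,d) = <a x b, c x d> - <a,c><b,d> + <a,d><b,c>.

Sufficiency. If xi is in g_2, the field X(p) = xi p preserves the 2-form
sigma_p(u,v) = phi(p,u,v), and d sigma = 3 omega on the sphere. Cartan's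
formula then gives i_X omega = d alpha with alpha = -1/3 i_X sigma, that is
alpha_p(u) = -1/3 phi(p, xi p, u) ([fundamental_solves_HDW]).

Necessity. From i_X omega = d alpha one gets d (i_X omega) = 0, hence
L_X omega = 0, and the point is to see that X must be an infinitesimal isometry.
The form omega is the real part of a complex volume form for J, and a real part
of this kind determines J and the imaginary part. So X also preserves the
imaginary part, which is i_p psi up to sign; infinitesimally this is the linear
algebra of [lie_psi_of_lie_omega]. The exterior derivative of i_p psi on the
sphere is 4 psi, so differentiating once more shows that X preserves the
restriction of psi ([frame_jacobian_lie_psi_tangent]). Together the two
statements say that the Jacobian A(p) of the extension of X to a homogeneous
field of degree 1 annihilates psi at every point. The annihilator of psi in
gl_7 consists of skew matrices which also annihilate phi ([stab_skew],
[stab_omega]). Since A is a skew-symmetric Jacobian it is constant, by the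
argument which makes Killing fields of a Euclidean space affine
([d_frame_jacobian0]); hence X(p) = A p.

Everything is computed in the two stereographic charts f. There A is the
matrix sending f to X and each D_u f to D_u X, and every use of d d = 0 becomes
the symmetry of second derivatives ([derive_comm]). The link with G_2 itself is
the differential equation of t |-> exp(t xi): a matrix is in g_2 as soon as it is
skew and annihilates phi, because phi(e^(t xi) u, e^(t xi) v, e^(t xi) w) and
<e^(t xi) u, e^(t xi) v> are then constant in t ([lie_omega_g2]), and conversely
differentiating at t = 0 shows that elements of g_2 annihilate phi
([g2_lie_omega]). *)

Set Implicit Arguments.
Unset Strict Implicit.
Unset Printing Implicit Defensive.

Import Order.TTheory GRing.Theory Num.Theory.
Import numFieldNormedType.Exports.

Local Open Scope classical_set_scope.
Local Open Scope ring_scope.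

(** * Coordinates of the cross product *)

Local Notation "i '%I7'" := (@Ordinal 7 i isT) (at level 2, format "i %I7").

Section CrossCoordinates.
Context {R : realType}.
Implicit Types (u v w a b c p : 'cV[R]_7).

Lemma sum7 (V : nmodType) (F : 'I_7 -> V) :
  \sum_i F i = F 0%I7 + F 1%I7 + F 2%I7 + F 3%I7 + F 4%I7 + F 5%I7 + F 6%I7.
Proof.
rewrite !big_ord_recr big_ord0 /= add0r.
by do ![congr (_ + _)]; congr F; apply: val_inj.
Qed.

Lemma ord7P (P : 'I_7 -> Prop) :
  P 0%I7 -> P 1%I7 -> P 2%I7 -> P 3%I7 -> P 4%I7 -> P 5%I7 -> P 6%I7 ->
  forall i, P i.
Proof.
move=> ? ? ? ? ? ? ? [[|[|[|[|[|[|[|//]]]]]]] h];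
  by rewrite (bool_irrelevance h isT).
Qed.

Lemma im_oct0 u : im_oct u ord0 0 = 0.
Proof. by rewrite /im_oct -[ord0](lshift0 7 0) (col_mxEu (0 : 'cV_1)) mxE. Qed.

Lemma im_octS u (i : 'I_7) : im_oct u (lift ord0 i) 0 = u i 0.
Proof. by rewrite -rshift1 /im_oct (col_mxEd (0 : 'cV_1)). Qed.

Lemma oct_mulE (x y : octonion R) k :
  oct_mul x y k 0 = \sum_i \sum_j x i 0 * y j 0 * oct_e_mul R i j k 0.
Proof.
rewrite /oct_mul summxE; apply: eq_bigr => i _; rewrite summxE.
by apply: eq_bigr => j _; rewrite mxE.
Qed.

Lemma oct_e_mul0 (i j : 'I_7) :
  oct_e_mul R (lift ord0 i) (lift ord0 j) ord0 0 = - (i == j)%:R.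
Proof.
rewrite /oct_e_mul /= !mxE eqxx mulr1 summxE big1 ?addr0 //.
by move=> k k0; rewrite !mxE eq_sym (negPf k0) mulr0.
Qed.

Lemma oct_e_mulS (i j k : 'I_7) :
  oct_e_mul R (lift ord0 i) (lift ord0 j) (lift ord0 k) 0 =
  (epsilon i.+1 j.+1 k.+1)%:~R.
Proof.
rewrite /oct_e_mul /= !mxE mulr0 oppr0 add0r summxE.
rewrite (bigD1 (lift ord0 k)) //= big1 ?addr0 ?mxE ?eqxx ?mulr1 //.
by move=> l /andP[_ lk]; rewrite !mxE eq_sym (negPf lk) mulr0.
Qed.

Lemma oct_mul_im0 u v : oct_mul (im_oct u) (im_oct v) ord0 0 = - dot u v.
Proof.
rewrite oct_mulE big_ord_recl big1 ?add0r; last first.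
  by move=> j _; rewrite im_oct0 !mul0r.
rewrite /dot -sumrN; apply: eq_bigr => i _.
rewrite big_ord_recl im_oct0 mulr0 mul0r add0r (bigD1 i) //= big1 ?addr0.
  by rewrite oct_e_mul0 eqxx mulrN1 !im_octS.
by move=> j ji; rewrite oct_e_mul0 eq_sym (negPf ji) oppr0 mulr0.
Qed.

Lemma oct_mul_imS u v k : oct_mul (im_oct u) (im_oct v) (lift ord0 k) 0 =
  \sum_(i < 7) \sum_(j < 7) u i 0 * v j 0 * (epsilon i.+1 j.+1 k.+1)%:~R.
Proof.
rewrite oct_mulE big_ord_recl big1 ?add0r; last first.
  by move=> j _; rewrite im_oct0 !mul0r.
apply: eq_bigr => i _.
rewrite big_ord_recl im_oct0 mulr0 mul0r add0r; apply: eq_bigr => j _.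
by rewrite oct_e_mulS !im_octS.
Qed.

Lemma cross_coord u v k : cross u v k 0 =
  2^-1 * (oct_mul (im_oct u) (im_oct v) (lift ord0 k) 0 -
          oct_mul (im_oct v) (im_oct u) (lift ord0 k) 0).
Proof. by rewrite /cross mxE -rshift1 !mxE. Qed.

Ltac eval_eps := repeat match goal with |- context [epsilon ?a ?b ?c] =>
  let t := eval vm_compute in (epsilon a b c) in
  change (epsilon a b c) with t end.

Lemma crossE u v :
 (cross u v 0%I7 0 =
   (u 1%I7 0 * v 2%I7 0 - u 2%I7 0 * v 1%I7 0) +
   (u 3%I7 0 * v 4%I7 0 - u 4%I7 0 * v 3%I7 0) +
   (u 5%I7 0 * v 6%I7 0 - u 6%I7 0 * v 5%I7 0)) *
 (cross u v 1%I7 0 =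
   (u 2%I7 0 * v 0%I7 0 - u 0%I7 0 * v 2%I7 0) +
   (u 3%I7 0 * v 5%I7 0 - u 5%I7 0 * v 3%I7 0) +
   (u 6%I7 0 * v 4%I7 0 - u 4%I7 0 * v 6%I7 0)) *
 (cross u v 2%I7 0 =
   (u 0%I7 0 * v 1%I7 0 - u 1%I7 0 * v 0%I7 0) +
   (u 6%I7 0 * v 3%I7 0 - u 3%I7 0 * v 6%I7 0) +
   (u 5%I7 0 * v 4%I7 0 - u 4%I7 0 * v 5%I7 0)) *
 (cross u v 3%I7 0 =
   (u 4%I7 0 * v 0%I7 0 - u 0%I7 0 * v 4%I7 0) +
   (u 5%I7 0 * v 1%I7 0 - u 1%I7 0 * v 5%I7 0) +
   (u 2%I7 0 * v 6%I7 0 - u 6%I7 0 * v 2%I7 0)) *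
 (cross u v 4%I7 0 =
   (u 0%I7 0 * v 3%I7 0 - u 3%I7 0 * v 0%I7 0) +
   (u 1%I7 0 * v 6%I7 0 - u 6%I7 0 * v 1%I7 0) +
   (u 2%I7 0 * v 5%I7 0 - u 5%I7 0 * v 2%I7 0)) *
 (cross u v 5%I7 0 =
   (u 6%I7 0 * v 0%I7 0 - u 0%I7 0 * v 6%I7 0) +
   (u 1%I7 0 * v 3%I7 0 - u 3%I7 0 * v 1%I7 0) +
   (u 4%I7 0 * v 2%I7 0 - u 2%I7 0 * v 4%I7 0)) *
 (cross u v 6%I7 0 =
   (u 0%I7 0 * v 5%I7 0 - u 5%I7 0 * v 0%I7 0) +
   (u 4%I7 0 * v 1%I7 0 - u 1%I7 0 * v 4%I7 0) +
   (u 3%I7 0 * v 2%I7 0 - u 2%I7 0 * v 3%I7 0)).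
Proof.
do ![split]; rewrite cross_coord !oct_mul_imS !sum7 /=; eval_eps.
all: by rewrite !NegzE !mulrNz !mulr1z !mulr0z; field.
Qed.

Lemma dot7 u v : dot u v = u 0%I7 0 * v 0%I7 0 + u 1%I7 0 * v 1%I7 0 +
  u 2%I7 0 * v 2%I7 0 + u 3%I7 0 * v 3%I7 0 + u 4%I7 0 * v 4%I7 0 +
  u 5%I7 0 * v 5%I7 0 + u 6%I7 0 * v 6%I7 0.
Proof. exact: sum7. Qed.

End CrossCoordinates.

(** * Scalar product, cross product and the 4-form psi *)

Section CrossIdentities.
Context {R : realType}.
Implicit Types (u v w a b c d p : 'cV[R]_7).

Lemma coordE : (forall u v i, (u + v) i 0 = u i 0 + v i 0) *
  (forall u i, (- u) i 0 = - u i 0) *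
  (forall k u i, (k *: u) i 0 = k * u i 0) *
  (forall i, (0 : 'cV[R]_7) i 0 = 0).
Proof. by do ![split] => *; rewrite !mxE. Qed.

Lemma crossC u v : cross u v = - cross v u.
Proof. apply/colP; elim/ord7P; rewrite !coordE !crossE; ring. Qed.

Lemma cross_linear_l (k : R) u v w :
  cross (k *: u + v) w = k *: cross u w + cross v w.
Proof. apply/colP; elim/ord7P; rewrite !coordE !crossE !coordE; ring. Qed.

Lemma dot_cross_cyc u v w : dot (cross u v) w = dot u (cross v w).
Proof. rewrite !dot7 !crossE; ring. Qed.

(** Polarization of a x (a x c) = <a,c> a - <a,a> c, which expresses that the
    octonions are alternative. With the cyclicity of <u x v, w>, it is the only
    property of the multiplication table used below for general vectors. *)
Lemma cross_cross a b c : cross a (cross b c) + cross b (cross a c) =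
  dot a c *: b + dot b c *: a - (2 * dot a b) *: c.
Proof. apply/colP; elim/ord7P; rewrite !coordE !crossE !dot7; ring. Qed.

End CrossIdentities.

Section DotAlgebra.
Context {R : realType} {n : nat}.
Implicit Types (u v w : 'cV[R]_n).

Lemma dotC u v : dot u v = dot v u.
Proof. by apply: eq_bigr => i _; rewrite mulrC. Qed.

Lemma dotDl u v w : dot (u + v) w = dot u w + dot v w.
Proof. by rewrite /dot -big_split; apply: eq_bigr => i _; rewrite mxE mulrDl. Qed.

Lemma dotZl (k : R) u w : dot (k *: u) w = k * dot u w.
Proof. by rewrite /dot mulr_sumr; apply: eq_bigr => i _; rewrite mxE mulrA. Qed.

Lemma dotNl u w : dot (- u) w = - dot u w.
Proof. by rewrite -scaleN1r dotZl mulN1r. Qed.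

Lemma dotDr u v w : dot w (u + v) = dot w u + dot w v.
Proof. by rewrite dotC dotDl !(dotC w). Qed.

Lemma dotZr (k : R) u w : dot w (k *: u) = k * dot w u.
Proof. by rewrite dotC dotZl (dotC w). Qed.

Lemma dotNr u w : dot w (- u) = - dot w u.
Proof. by rewrite dotC dotNl (dotC w). Qed.

Definition dotE := (dotDl, dotDr, dotNl, dotNr, dotZl, dotZr).

Lemma dot_delta u i : dot u (delta_mx i 0) = u i 0.
Proof.
rewrite /dot (bigD1 i) //= big1 ?addr0; first by rewrite mxE !eqxx mulr1.
by move=> j ji; rewrite mxE (negPf ji) mulr0.
Qed.

Lemma dot_inj u v : (forall w, dot u w = dot v w) -> u = v.
Proof. by move=> uv; apply/colP => i; rewrite -!dot_delta. Qed.

Lemma dot_ge0 u : 0 <= dot u u.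
Proof. by apply: sumr_ge0 => i _; rewrite -expr2 sqr_ge0. Qed.

Lemma dot_eq0 u : dot u u = 0 -> u = 0.
Proof.
move/eqP; rewrite psumr_eq0 => [/allP z0|i _]; last by rewrite -expr2 sqr_ge0.
apply/colP => i; rewrite mxE; have := z0 i; rewrite mem_index_enum mulf_eq0 orbb.
by move=> /(_ isT)/eqP.
Qed.

Lemma dot_trmx (A : 'M[R]_n) u v : dot (A *m u) v = dot u (A^T *m v).
Proof.
rewrite /dot; under eq_bigr do rewrite mxE mulr_suml.
rewrite exchange_big; apply: eq_bigr => i _; rewrite mxE mulr_sumr.
by apply: eq_bigr => j _; rewrite mxE mulrAC mulrC mulrA.
Qed.

End DotAlgebra.

Section CrossAlgebra.
Context {R : realType}.
Implicit Types (u v w a b c d p X : 'cV[R]_7) (A : 'M[R]_7).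

Lemma crossDl u v w : cross (u + v) w = cross u w + cross v w.
Proof. by rewrite -[u]scale1r cross_linear_l !scale1r. Qed.

Lemma cross0l w : cross 0 w = 0.
Proof. by apply: (addrI (cross 0 w)); rewrite -crossDl !addr0. Qed.

Lemma crossZl (k : R) u w : cross (k *: u) w = k *: cross u w.
Proof. by rewrite -[k *: u]addr0 cross_linear_l cross0l addr0. Qed.

Lemma crossNl u w : cross (- u) w = - cross u w.
Proof. by rewrite -scaleN1r crossZl scaleN1r. Qed.

Lemma crossDr u v w : cross w (u + v) = cross w u + cross w v.
Proof. by rewrite crossC crossDl opprD -!(crossC w). Qed.

Lemma crossZr (k : R) u w : cross w (k *: u) = k *: cross w u.
Proof. by rewrite crossC crossZl -scalerN -crossC. Qed.

Lemma crossNr u w : cross w (- u) = - cross w u.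
Proof. by rewrite -scaleN1r crossZr scaleN1r. Qed.

Definition bilinE :=
  (@dotE R 7, crossDl, crossDr, crossNl, crossNr, crossZl, crossZr).

Lemma crossvv u : cross u u = 0.
Proof.
have /colP E : cross u u + cross u u = 0 by rewrite {1}crossC addNr.
by apply/colP => i; have := E i; rewrite !coordE; lra.
Qed.

Lemma cross_crossvv p a : cross p (cross p a) = dot p a *: p - dot p p *: a.
Proof.
have /colP E := cross_cross p p a.
by apply/colP => i; have := E i; rewrite !coordE; lra.
Qed.

(** Up to sign, the coassociative calibration of R^7, that is, the Hodge dual of
    [omega_tilde]. *)
Definition psi a b c d :=
  dot (cross a b) (cross c d) - dot a c * dot b d + dot a d * dot b c.

Lemma omega_cyc u v w : omega_tilde u v w = omega_tilde v w u.
Proof. by rewrite /omega_tilde dot_cross_cyc dotC. Qed.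

Lemma omega_swap u v w : omega_tilde u v w = - omega_tilde v u w.
Proof. by rewrite /omega_tilde crossC dotNl. Qed.

Lemma psi_swap12 a b c d : psi a b c d = - psi b a c d.
Proof. rewrite /psi (crossC a b) dotNl; ring. Qed.

Lemma psi_swap34 a b c d : psi a b c d = - psi a b d c.
Proof. rewrite /psi (crossC c d) dotNr; ring. Qed.

(** The only slot exchange that is not visible on the formula; with the two
    others it makes psi alternating. *)
Lemma psi_swap23 a b c d : psi a b c d = - psi a c b d.
Proof.
have := congr1 (dot c) (cross_cross d a b); rewrite !dotE.
have E1 : dot c (cross d (cross a b)) = dot (cross a b) (cross c d).
  by rewrite -dot_cross_cyc dotC.
have E2 : dot c (cross a (cross d b)) = dot (cross a c) (cross b d).
  by rewrite -dot_cross_cyc (crossC c a) (crossC d b) !bilinE opprK.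
rewrite E1 E2 /psi (dotC d a) (dotC d b) (dotC c a) (dotC c b) (dotC c d); lra.
Qed.

Lemma psi_linear_l (k : R) a a' b c d :
  psi (k *: a + a') b c d = k * psi a b c d + psi a' b c d.
Proof. rewrite /psi !bilinE; ring. Qed.

End CrossAlgebra.

(** * The almost complex structure at a point of the sphere *)

Section SphereAlgebra.
Context {R : realType}.
Implicit Types (u v w a b c d p X : 'cV[R]_7) (A : 'M[R]_7).

Lemma dot_crossl p a : dot p (cross p a) = 0.
Proof. by rewrite -dot_cross_cyc crossvv -[0](scale0r 0) dotZl mul0r. Qed.

Lemma dot_cross_skew p a b : dot (cross p a) b = - dot a (cross p b).
Proof. by rewrite crossC dotNl dot_cross_cyc. Qed.

(** [lie_omega A] and [lie_psi A] are the Lie derivatives of the two constant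
    coefficient forms along the linear vector field A. *)
Definition lie_omega A u v w :=
  omega_tilde (A *m u) v w + omega_tilde u (A *m v) w + omega_tilde u v (A *m w).

Definition lie_psi A a b c d := psi (A *m a) b c d + psi a (A *m b) c d
  + psi a b (A *m c) d + psi a b c (A *m d).

Section AtPoint.
Context (p : 'cV[R]_7) (pp : dot p p = 1).
Local Notation J := (cross p).
Local Notation tangent u := (dot p u = 0).

Lemma JJ a : J (J a) = dot p a *: p - a.
Proof. by rewrite cross_crossvv pp scale1r. Qed.

Lemma dotJ a b : dot a (J b) = - dot (J a) b.
Proof. by rewrite dot_cross_skew opprK. Qed.

Lemma J_cross v w : tangent v -> tangent w ->
  cross (J v) w = - (dot v w *: p) - J (cross v w).
Proof.
move=> pv pw; have /colP E := cross_cross w p v; have /colP F := cross_cross p w v.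
apply/colP => i; have := E i; have := F i.
rewrite [cross (J v) w]crossC (crossC w v) bilinE !coordE (dotC w p) pv pw.
by rewrite (dotC w v); lra.
Qed.

(** J can be moved between the slots of phi on tangent vectors: phi restricted to
    the tangent space is the real part of a J-trilinear form. The extra term
    records the component of b along p, which need not vanish below. *)
Lemma J_omega2 b v w : tangent v -> tangent w ->
  omega_tilde b (J v) w = omega_tilde (J b) v w - dot v w * dot p b.
Proof.
move=> pv pw; rewrite /omega_tilde dot_cross_cyc (dot_cross_cyc (J b)) J_cross // !bilinE.
by rewrite dot_cross_skew (dotC b p); ring.
Qed.

Lemma J_omega3 b v w : tangent v -> tangent w ->
  omega_tilde b v (J w) = omega_tilde (J b) v w + dot v w * dot p b.
Proof.
move=> pv pw; have := J_omega2 b pw pv.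
have E (x y z : 'cV[R]_7) : omega_tilde x y z = - omega_tilde x z y.
  by rewrite 2!omega_cyc omega_swap -omega_cyc.
by rewrite (E b) (E (J b)) (dotC w v); lra.
Qed.

(** A trilinear form of type (3,0) changes sign when J is put in two slots. *)
Lemma omega_J23 b v w : tangent v -> tangent w ->
  omega_tilde b (J v) (J w) =
  2 * dot p b * dot (J v) w - omega_tilde b v w.
Proof.
move=> pv pw; rewrite J_omega2 ?dot_crossl // J_omega3 // dot_crossl JJ.
have -> : dot v (J w) = - dot (J v) w by rewrite dot_cross_skew opprK.
by rewrite /omega_tilde !bilinE; ring.
Qed.

(** Put psi_i for psi with J in slot i. This computes psi_1 + psi_3, and by
    alternation every psi_i + psi_j, so that each psi_i is explicit. *)
Lemma psi_J13 X u v w : tangent X -> tangent u -> tangent v -> tangent w ->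
  psi (J X) u v w + psi X u (J v) w =
  dot (J X) w * dot u v - dot (J X) u * dot v w
  - dot X u * dot (J v) w - dot X w * dot (J u) v.
Proof.
move=> pX pu pv pw; rewrite /psi (J_cross pv pw) !bilinE.
have -> : dot (cross X u) (J (cross v w)) =
    dot X u * dot (J v) w + dot (cross (J X) u) (cross v w).
  have /(congr1 (fun z => dot z (cross v w))) := J_cross pX pu.
  rewrite !bilinE (dot_cross_skew p (cross X u)) (dot_cross_cyc p v w) => ->.
  by ring.
have -> : dot (cross X u) p = dot (J X) u by rewrite -/(omega_tilde _ _ _) -omega_cyc.
by rewrite !dotJ; ring.
Qed.

(** On tangent vectors psi is half the square of the Kaehler form
    <J u, v>. It is read off psi_1 = ((psi_1 + psi_2) + (psi_1 + psi_3)
    - (psi_2 + psi_3)) / 2 applied to J X, since J J X = - X. *)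
Lemma psi_kahler X u v w :
  tangent X -> tangent u -> tangent v -> tangent w ->
  psi X u v w = - (dot X (J u) * dot (J v) w + dot X (J v) * dot (J w) u
                   + dot X (J w) * dot (J u) v).
Proof.
move=> pX pu pv pw; have pZ : tangent (J X) := dot_crossl p X.
have := psi_J13 pZ pu pv pw; have := psi_J13 pZ pv pu pw.
have := psi_J13 pu pZ pv pw; rewrite JJ pX scale0r add0r.
have psiN a b c d : psi (- a) b c d = - psi a b c d.
  by rewrite /psi !bilinE; ring.
rewrite (psi_swap23 (J X)) (psi_swap12 (J u)) (psi_swap12 u).
rewrite !(psi_swap23 (- X) v) !psiN !dotE.
have dotJs a b : dot (J b) a = - dot (J a) b by rewrite dotC dotJ.
rewrite !dotJ !JJ pu scale0r !add0r !dotE (dotC u X) (dotC v u).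
rewrite (dotJs w v) (dotJs u w) (dotJs v u) (dotJs X u).
lra.
Qed.

(** The infinitesimal form of the fact that the real part of a complex volume form
    determines its imaginary part. Let B be the tangential part of A and theta the
    action of B on phi. Moving J across phi, most terms of
    theta(Ju,v,w) + theta(u,Jv,w) + theta(u,v,Jw) + theta(Ju,Jv,Jw) cancel and the
    others add up to twice the action of B on phi(J.,.,.), which is i_p psi. The
    hypothesis on <p, A u> (the field stays tangent to the spheres) turns the
    normal part of A into terms <X, J u> <J v, w>, which [psi_kahler] identifies
    with psi(X,u,v,w). *)
Lemma lie_psi_of_lie_omega A X : tangent X -> A *m p = X ->
  (forall u, tangent u -> dot p (A *m u) = - dot X u) ->
  (forall u v w, tangent u -> tangent v -> tangent w -> lie_omega A u v w = 0) ->
  forall u v w, tangent u -> tangent v -> tangent w -> lie_psi A p u v w = 0.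
Proof.
move=> pX Ap pA Aomega u v w pu pv pw.
have pJ a : tangent (J a) := dot_crossl p a.
have cyc2 (a b c : 'cV[R]_7) : omega_tilde a b c = omega_tilde c a b.
  by rewrite -omega_cyc.
have T1 := Aomega _ _ _ (pJ u) pv pw.
have T2 := Aomega _ _ _ pu (pJ v) pw.
have T3 := Aomega _ _ _ pu pv (pJ w).
have T4 := Aomega _ _ _ (pJ u) (pJ v) (pJ w).
move: T1 T2 T3 T4; rewrite /lie_omega.
rewrite !(omega_cyc _ (A *m _)) !(cyc2 _ _ (A *m _)).
rewrite !omega_J23 // !J_omega2 // !J_omega3 // !pA //.
have psip a b c : tangent b -> tangent c -> psi p a b c = omega_tilde (J a) b c.
  by move=> pb pc; rewrite /psi pb pc /omega_tilde (dot_cross_cyc (J a)); ring.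
have -> : lie_psi A p u v w = psi X u v w + psi p (A *m u) v w
    + psi p (A *m v) w u + psi p (A *m w) u v.
  rewrite /lie_psi Ap; congr (_ + _ + _ + _).
    by rewrite psi_swap23 psi_swap34 opprK.
  by rewrite psi_swap34 psi_swap23 opprK.
rewrite !psip // psi_kahler //.
lra.
Qed.

End AtPoint.

Lemma lie_psi_linear A (k : R) a a' b c d :
  lie_psi A (k *: a + a') b c d = k * lie_psi A a b c d + lie_psi A a' b c d.
Proof.
by rewrite /lie_psi mulmxDr -scalemxAr !psi_linear_l; ring.
Qed.

Lemma lie_psi_swap12 A a b c d : lie_psi A a b c d = - lie_psi A b a c d.
Proof.
rewrite /lie_psi !(psi_swap12 a) !(psi_swap12 (A *m a)); ring.
Qed.

Lemma lie_psi_swap23 A a b c d : lie_psi A a b c d = - lie_psi A a c b d.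
Proof.
rewrite /lie_psi !(psi_swap23 _ b) !(psi_swap23 _ (A *m b)); ring.
Qed.

Lemma lie_psi_swap34 A a b c d : lie_psi A a b c d = - lie_psi A a b d c.
Proof.
rewrite /lie_psi !(psi_swap34 _ _ c) !(psi_swap34 _ _ (A *m c)); ring.
Qed.

Lemma lie_psi_frame A p : dot p p = 1 ->
  (forall u v w, dot p u = 0 -> dot p v = 0 -> dot p w = 0 ->
    lie_psi A p u v w = 0) ->
  (forall z u v w, dot p z = 0 -> dot p u = 0 -> dot p v = 0 -> dot p w = 0 ->
    lie_psi A z u v w = 0) ->
  forall a b c d, lie_psi A a b c d = 0.
Proof.
move=> pp Hp H.
have dec a : exists (k : R) (t : 'cV[R]_7), a = k *: p + t /\ dot p t = 0.
  exists (dot p a), (a - dot p a *: p); split; first by rewrite addrC subrK.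
  by rewrite !dotE pp; ring.
have L1 a b c d : dot p b = 0 -> dot p c = 0 -> dot p d = 0 -> lie_psi A a b c d = 0.
  move=> pb pc pd; have [k [t [-> pt]]] := dec a.
  by rewrite lie_psi_linear Hp // H // mulr0 addr0.
have Z b c : lie_psi A p p b c = 0.
  by have := lie_psi_swap12 A p p b c; lra.
have normal_tangent a b c d : lie_psi A p b c d = 0 ->
    (forall t, dot p t = 0 -> lie_psi A t b c d = 0) -> lie_psi A a b c d = 0.
  move=> Hp' Ht; have [k [t [-> pt]]] := dec a.
  by rewrite lie_psi_linear Hp' Ht // mulr0 addr0.
have L2 a b c d : dot p c = 0 -> dot p d = 0 -> lie_psi A a b c d = 0.
  move=> pc pd; apply: (normal_tangent) => [|t pt].
    rewrite lie_psi_swap12 (normal_tangent b) ?oppr0 // => t pt.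
    by rewrite lie_psi_swap12 L1 ?oppr0.
  by rewrite lie_psi_swap12 L1 ?oppr0.
have L3 a b c d : dot p d = 0 -> lie_psi A a b c d = 0.
  move=> pd; apply: (normal_tangent) => [|t pt].
    rewrite lie_psi_swap23 lie_psi_swap12 opprK (normal_tangent c) // => t pt.
    by rewrite lie_psi_swap12 lie_psi_swap23 L2 ?oppr0.
  by rewrite lie_psi_swap12 lie_psi_swap23 L2 ?oppr0.
move=> a b c d; apply: (normal_tangent) => [|t pt].
  rewrite lie_psi_swap34 lie_psi_swap23 lie_psi_swap12.
  rewrite (normal_tangent d) ?oppr0 // => t pt.
  by rewrite lie_psi_swap12 lie_psi_swap23 lie_psi_swap34 L3 ?oppr0.
by rewrite lie_psi_swap12 lie_psi_swap23 lie_psi_swap34 L3 ?oppr0.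
Qed.

End SphereAlgebra.

(** * The annihilator of psi in gl_7 *)

Section AnnihilatorLines.
Context {R : realType}.
Implicit Types (u v w a b c d p x y : 'cV[R]_7).

Lemma dot_cross_cross a x : dot (cross a x) (cross a x) =
  dot a a * dot x x - dot a x ^+ 2.
Proof.
rewrite (dot_cross_skew a) cross_crossvv !dotE (dotC x a); ring.
Qed.

Lemma dot_crossr a b : dot b (cross a b) = 0.
Proof. by rewrite crossC dotNr dot_crossl oppr0. Qed.

Lemma cross_anti a b c : dot a b = 0 -> dot a c = 0 -> dot b c = 0 ->
  cross a (cross b c) = - cross b (cross a c).
Proof.
move=> ab ac bc; apply/eqP; rewrite -addr_eq0 cross_cross ab ac bc.
by rewrite mulr0 !scale0r oppr0 !addr0.
Qed.

(** The vector dual to psi(., b, c, d). *)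
Definition triple b c d := cross b (cross c d) + dot b c *: d - dot b d *: c.

Section Stab.
Context (A : 'M[R]_7).

Lemma lie_psiE a b c d : lie_psi A a b c d =
  dot (A *m a) (triple b c d) - dot (A *m b) (triple a c d)
  + dot (A *m c) (triple a b d) - dot (A *m d) (triple a b c).
Proof.
have E x b' c' d' : psi x b' c' d' = dot x (triple b' c' d').
  by rewrite /psi /triple dot_cross_cyc !dotE; ring.
rewrite /lie_psi -!E (psi_swap12 a (A *m b)) (psi_swap23 a b) (psi_swap12 a).
by rewrite (psi_swap34 a b) (psi_swap23 a b) (psi_swap12 a); ring.
Qed.

Let Q d x := dot (A *m x) (cross d x).

Let QN d x : Q d (- x) = Q d x.
Proof. by rewrite /Q mulmxN crossNr dotNl dotNr opprK. Qed.

Context (Apsi : forall a b c d, lie_psi A a b c d = 0).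

(** The condition on A is evaluated on a, b, a x b and a fourth vector d orthogonal
    to this quaternionic triple: one vector contributes nothing and the three
    others enter through the single quadratic form Q. *)
Lemma stab_line a b d : dot a b = 0 -> dot d a = 0 -> dot d b = 0 ->
  dot d (cross a b) = 0 ->
  dot b b * Q d a + dot a a * Q d b + Q d (cross a b) = 0.
Proof.
move=> ab da db dc; have ba := ab; rewrite dotC in ba.
have cd : dot (cross a b) d = 0 by rewrite dotC.
have bd : dot b d = 0 by rewrite dotC.
have ad : dot a d = 0 by rewrite dotC.
have cab : cross b (cross a b) = dot b b *: a.
  by rewrite (crossC a) crossNr cross_crossvv ba scale0r sub0r opprK.
have T1 : triple b (cross a b) d = dot b b *: cross d a.
  rewrite /triple dot_crossr bd !scale0r subr0 addr0 (crossC (cross a b)) crossNr.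
  by rewrite (cross_anti bd (dot_crossr _ _) dc) opprK cab crossZr.
have T2 : triple a (cross a b) d = - (dot a a *: cross d b).
  rewrite /triple dot_crossl ad !scale0r subr0 addr0 (crossC (cross a b)) crossNr.
  rewrite (cross_anti ad (dot_crossl _ _) dc) opprK cross_crossvv ab.
  by rewrite scale0r sub0r crossNr crossZr.
have T3 : triple a b d = cross d (cross a b).
  rewrite /triple ab ad !scale0r subr0 addr0 (crossC b) crossNr.
  by rewrite (cross_anti ad ab db) opprK.
have T4 : triple a b (cross a b) = dot b b *: cross a a.
  by rewrite /triple ab dot_crossl !scale0r subr0 addr0 cab crossZr.
have := Apsi a b (cross a b) d; rewrite lie_psiE T1 T2 T3 T4 crossvv scaler0.
rewrite dotNr !dotZr -[0](scale0r 0) dotZr /Q; lra.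
Qed.

(** The previous lemma for the four pairs (a,b), (a,b'), (a',b), (a',b') with
    x' = d x x: their third vectors are a x b or d x (a x b) up to sign, so that the
    combination + + - - leaves 2 Q(a) = 2 Q(a'). This is the symmetric part of A on
    the orthogonal pair a, d x a. *)
Lemma stab_pair a b d : dot d d = 1 -> dot b b = 1 ->
  dot d a = 0 -> dot d b = 0 -> dot a b = 0 -> dot (cross d a) b = 0 ->
  dot (A *m a) (cross d a) + dot (A *m cross d a) a = 0.
Proof.
move=> dd bb da db ab dab; pose a' := cross d a; pose b' := cross d b.
pose c := cross a b.
have ba : dot b a = 0 by rewrite dotC.
have ad : dot a d = 0 by rewrite dotC.
have dc : dot d c = 0 by rewrite -dot_cross_cyc.
have ab' : dot a b' = 0 by rewrite dotJ dab oppr0.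
have cab' : cross a b' = - cross d c by rewrite cross_anti.
have ca'b : cross a' b = - cross d c.
  by rewrite crossC cross_anti ?opprK 1?dotC // (crossC b) crossNr.
have a'b : dot a' b = 0 := dab.
have da' : dot d a' = 0 by exact: dot_crossl.
have a'd : dot a' d = 0 by rewrite dotC.
have ca'b' : cross a' b' = - c.
  rewrite (cross_anti a'd a'b db) ca'b crossNr opprK cross_crossvv dc dd.
  by rewrite scale0r scale1r sub0r.
have a'b' : dot a' b' = 0.
  by rewrite dot_cross_skew cross_crossvv db dd scale0r scale1r sub0r dotNr ab !oppr0.
have a'a' : dot a' a' = dot a a by rewrite dot_cross_cross dd da expr0n subr0 mul1r.
have b'b' : dot b' b' = 1 by rewrite dot_cross_cross dd db expr0n subr0 mul1r.
have db' : dot d b' = 0 by exact: dot_crossl.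
have ddc : dot d (- cross d c) = 0 by rewrite dotNr dot_crossl oppr0.
have := stab_line ab da db dc.
have := @stab_line a b' d ab' da db'; rewrite cab' => /(_ ddc).
have := @stab_line a' b d dab da' db; rewrite ca'b => /(_ ddc).
have := @stab_line a' b' d a'b' da' db'; rewrite ca'b' dotNr dc oppr0 => /(_ erefl).
rewrite !QN bb b'b' a'a' -/c => E1 E2 E3 E4.
have : Q d a = Q d a'.
  move: (Q d a) (Q d a') (Q d b) (Q d b') (Q d c) (Q d (cross d c)) E1 E2 E3 E4.
  by move: (dot a a); clear; move=> *; lra.
rewrite /Q {2}/a' => ->; rewrite -/a' cross_crossvv da dd scale0r scale1r sub0r dotNr.
by rewrite addNr.
Qed.

End Stab.

End AnnihilatorLines.

Section AnnihilatorBasis.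
Context {R : realType}.
Implicit Types (u v w a b c d p x y : 'cV[R]_7).

Local Notation e i := (delta_mx i 0 : 'cV[R]_7).

(** A finite check on the table: antisymmetry, and a third basis vector off the
    line through two given ones. *)
Lemma epsilon_check : all (fun i => all (fun j =>
    all (fun k => epsilon j.+1 i.+1 k.+1 == - epsilon i.+1 j.+1 k.+1) (iota 0 7)
    && ((i == j) || has (fun k => [&& k != i, k != j & epsilon i.+1 j.+1 k.+1 == 0])
                        (iota 0 7)))
  (iota 0 7)) (iota 0 7).
Proof. by vm_compute. Qed.

Lemma epsilon_anti (i j k : 'I_7) :
  epsilon j.+1 i.+1 k.+1 = - epsilon i.+1 j.+1 k.+1.
Proof.
have /allP/(_ i)/[!mem_iota]/(_ (ltn_ord i))/allP/(_ j) := epsilon_check.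
by rewrite mem_iota => /(_ (ltn_ord j))/andP[/allP/(_ k)/[!mem_iota]/(_ (ltn_ord k))/eqP].
Qed.

Lemma epsilon_ex0 (i j : 'I_7) : i != j ->
  exists k : 'I_7, [/\ k != i, k != j & epsilon i.+1 j.+1 k.+1 = 0].
Proof.
move=> ij; have /allP/(_ i)/[!mem_iota]/(_ (ltn_ord i))/allP/(_ j) := epsilon_check.
rewrite mem_iota => /(_ (ltn_ord j))/andP[_]; rewrite (negPf (ij : val i != val j)).
case/hasP => k; rewrite mem_iota => k7 /and3P[ki kj /eqP k0].
by exists (Ordinal (k7 : (k < 7)%N)).
Qed.

Lemma cross_delta (i j k : 'I_7) :
  cross (e i) (e j) k 0 = (epsilon i.+1 j.+1 k.+1)%:~R.
Proof.
have E (a b : 'I_7) :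
    oct_mul (im_oct (e a)) (im_oct (e b)) (lift ord0 k) 0 =
    (epsilon a.+1 b.+1 k.+1)%:~R.
  rewrite oct_mul_imS (bigD1 a) //= [X in _ + X]big1 ?addr0 => [|a' /negPf aa'];
    last first.
    by apply: big1 => b' _; rewrite !mxE aa' !mul0r.
  rewrite (bigD1 b) //= big1 ?addr0 => [|b' /negPf bb']; last first.
    by rewrite !mxE bb' mulr0 mul0r.
  by rewrite !mxE !eqxx !mul1r.
rewrite cross_coord !E (epsilon_anti i j) mulrNz; lra.
Qed.

Lemma dot_deltas (i j : 'I_7) : dot (e i) (e j) = (i == j)%:R.
Proof. by rewrite dot_delta mxE eqxx andbT eq_sym. Qed.

Section Stab.
Context (A : 'M[R]_7) (Apsi : forall a b c d, lie_psi A a b c d = 0).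

Lemma mul_delta i j : dot (A *m e j) (e i) = A i j.
Proof. by rewrite dot_delta -colE mxE. Qed.

(** [stab_pair] applied to e_i and to e_i + e_j: the vector d = e_j x e_i sends e_i
    to - e_j and e_i + e_j to e_i - e_j, both pairs being orthogonal. *)
Lemma stab_offdiag i j : i != j -> A i j + A j i = 0 /\ A i i = A j j.
Proof.
move=> ij; have [k [ki kj k0]] := epsilon_ex0 ij.
have ii : dot (e i) (e i) = 1 by rewrite dot_deltas eqxx.
have jj : dot (e j) (e j) = 1 by rewrite dot_deltas eqxx.
have kk : dot (e k) (e k) = 1 by rewrite dot_deltas eqxx.
have oij : dot (e i) (e j) = 0 by rewrite dot_deltas (negPf ij).
have oji : dot (e j) (e i) = 0 by rewrite dotC.
have oik : dot (e i) (e k) = 0 by rewrite dot_deltas eq_sym (negPf ki).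
have ojk : dot (e j) (e k) = 0 by rewrite dot_deltas eq_sym (negPf kj).
pose d := cross (e j) (e i).
have dd : dot d d = 1.
  by rewrite dot_cross_cross ii jj oji expr0n subr0 mul1r.
have di : cross d (e i) = - e j.
  rewrite crossC /d (crossC (e j)) crossNr opprK cross_crossvv oij ii.
  by rewrite scale0r scale1r sub0r.
have dj : cross d (e j) = e i.
  rewrite crossC cross_crossvv oji jj.
  by rewrite scale0r scale1r sub0r opprK.
have dk : dot d (e k) = 0.
  by rewrite dot_delta cross_delta epsilon_anti k0.
have dei : dot d (e i) = 0 by rewrite dotC dot_crossr.
have dej : dot d (e j) = 0 by rewrite dotC dot_crossl.
split.
  have := stab_pair Apsi dd kk dei dk oik.
  rewrite di dotNl ojk oppr0 => /(_ erefl).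
  rewrite mulmxN dotNl dotNr !mul_delta; lra.
have d1 : dot d (e i + e j) = 0 by rewrite dotDr dei dej addr0.
have o1 : dot (e i + e j) (e k) = 0 by rewrite dotDl oik ojk addr0.
have := stab_pair Apsi dd kk d1 dk o1.
rewrite crossDr di dj dotDl dotNl oik ojk oppr0 addr0 => /(_ erefl).
rewrite !mulmxDr mulmxN !dotDl !dotDr !dotNl !dotNr !mul_delta; lra.
Qed.

Lemma stab_trmx : A^T = (2 * A 0 0)%:M - A.
Proof.
apply/matrixP => i j; rewrite !mxE; case: eqVneq => [->|ij].
  case: (eqVneq j 0) => [->|j0]; first by rewrite mulr1n; ring.
  by have [_ ->] := stab_offdiag j0; rewrite mulr1n; ring.
by have [E _] := stab_offdiag ij; rewrite mulr0n; lra.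
Qed.

Lemma stab_quadratic v : dot (A *m v) v = A 0 0 * dot v v.
Proof.
have : dot (A *m v) v + dot v (A *m v) = 2 * A 0 0 * dot v v.
  rewrite dot_trmx stab_trmx mulmxBl dotDr dotNr mul_scalar_mx dotZr.
  by rewrite subrK.
rewrite (dotC v); lra.
Qed.

End Stab.

End AnnihilatorBasis.

Section Annihilator.
Context {R : realType}.
Implicit Types (u v w a b c d p x y : 'cV[R]_7).
Local Notation e i := (delta_mx i 0 : 'cV[R]_7).

Section Stab.
Context (A : 'M[R]_7).

Lemma lie_omega_linear (k : R) u u' v w :
  lie_omega A (k *: u + u') v w = k * lie_omega A u v w + lie_omega A u' v w.
Proof. rewrite /lie_omega mulmxDr -scalemxAr /omega_tilde !bilinE; ring. Qed.

Lemma lie_omegaZ (k : R) u v w :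
  lie_omega A (k *: u) v w = k * lie_omega A u v w.
Proof. rewrite /lie_omega -scalemxAr /omega_tilde !bilinE; ring. Qed.

Lemma lie_omega_cyc u v w : lie_omega A u v w = lie_omega A v w u.
Proof.
rewrite /lie_omega (omega_cyc _ v w) (omega_cyc u (A *m v)) (omega_cyc u v (A *m w)).
ring.
Qed.

Lemma lie_omega_swap u v w : lie_omega A u v w = - lie_omega A v u w.
Proof.
rewrite /lie_omega (omega_swap _ v w) (omega_swap u (A *m v)) (omega_swap u v (A *m w)).
ring.
Qed.

Lemma eq0_on_basis (f : 'cV[R]_7 -> R) :
  (forall k u v, f (k *: u + v) = k * f u + f v) ->
  (forall i, f (e i) = 0) -> forall u, f u = 0.
Proof.
move=> flin fe u; rewrite [u]matrix_sum_delta.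
have f0 : f 0 = 0 by have := flin (-1) 0 0; rewrite scaler0 addr0; lra.
apply: (big_ind (fun x => f x = 0)) => // [x y fx fy|i _].
  by rewrite -[x]scale1r flin fx fy mulr0 addr0.
by rewrite big_ord1 -[_ *: _]addr0 flin fe f0 mulr0 addr0.
Qed.

Lemma lie_omega_basis :
  (forall i j k, lie_omega A (e i) (e j) (e k) = 0) ->
  forall u v w, lie_omega A u v w = 0.
Proof.
move=> H u v w; move: u; apply: eq0_on_basis => [k u u'|i].
  exact: lie_omega_linear.
rewrite lie_omega_cyc; move: v; apply: eq0_on_basis => [k u u'|j].
  exact: lie_omega_linear.
rewrite lie_omega_cyc; move: w; apply: eq0_on_basis => [k u u'|k].
  exact: lie_omega_linear.
by rewrite lie_omega_cyc.
Qed.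

Context (Apsi : forall a b c d, lie_psi A a b c d = 0).

(** For orthonormal vectors not spanning a quaternionic triple, the product
    a x (b x c) is cyclically symmetric, and multiplication by it sends each
    vector to the product of the two others. *)
Lemma triple_facts a b c : dot a a = 1 -> dot b b = 1 -> dot c c = 1 ->
  dot a b = 0 -> dot a c = 0 -> dot b c = 0 -> dot (cross a b) c = 0 ->
  let d := cross a (cross b c) in
  [/\ cross d a = cross b c, cross d b = cross c a, cross d c = cross a b &
      [/\ dot d d = 1, dot a d = 0, dot b d = 0 & dot c d = 0]].
Proof.
move=> aa bb cc ab ac bc abc d.
have ca : dot c a = 0 by rewrite dotC.
have cb : dot c b = 0 by rewrite dotC.
have unit_step x y : dot x x = 1 -> dot x y = 0 -> cross (cross x y) x = y.
  move=> xx xy; rewrite crossC cross_crossvv xx xy scale0r scale1r sub0r.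
  by rewrite opprK.
have bca : dot b (cross c a) = 0 by rewrite -dot_cross_cyc dotC -dot_cross_cyc.
have cab : dot c (cross a b) = 0 by rewrite dotC.
have a_bc : dot a (cross b c) = 0 by rewrite -dot_cross_cyc.
have dE2 : d = cross b (cross c a).
  by rewrite /d cross_anti // (crossC c a) crossNr.
have dE3 : d = cross c (cross a b).
  by rewrite /d (crossC b c) crossNr (cross_anti ac ab cb) opprK.
split; [exact: unit_step|by rewrite dE2 unit_step|by rewrite dE3 unit_step|].
split; [|exact: dot_crossl|by rewrite dE2 dot_crossl|by rewrite dE3 dot_crossl].
by rewrite /d dot_cross_cross a_bc aa dot_cross_cross bb cc bc; ring.
Qed.

(** So far A is skew up to a multiple of the identity. The multiple is detected by
    the action on psi at one orthonormal quadruple where psi does not vanish. *)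
Lemma stab_trace0 : A 0 0 = 0.
Proof.
pose a := e 0%I7; pose b := e 1%I7; pose c := e 3%I7.
have aa : dot a a = 1 by rewrite dot_deltas.
have bb : dot b b = 1 by rewrite dot_deltas.
have cc : dot c c = 1 by rewrite dot_deltas.
have ab : dot a b = 0 by rewrite dot_deltas.
have ac : dot a c = 0 by rewrite dot_deltas.
have bc : dot b c = 0 by rewrite dot_deltas.
have abc : dot (cross a b) c = 0 by rewrite dot_delta cross_delta.
have := triple_facts aa bb cc ab ac bc abc; set d := cross a _.
move=> [da db dc [dd ad bd cd]].
have T1 : triple b c d = - a.
  rewrite /triple bc bd !scale0r subr0 addr0 (crossC c) dc (crossC a) opprK.
  by rewrite cross_crossvv dotC ab bb scale0r scale1r sub0r.
have T2 : triple a c d = b.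
  rewrite /triple ac ad !scale0r subr0 addr0 (crossC c) dc crossNr.
  by rewrite cross_crossvv ab aa scale0r scale1r sub0r opprK.
have T3 : triple a b d = - c.
  rewrite /triple ab ad !scale0r subr0 addr0 (crossC b) db (crossC c) opprK.
  by rewrite cross_crossvv ac aa scale0r scale1r sub0r.
have T4 : triple a b c = d by rewrite /triple ab ac !scale0r subr0 addr0.
have := Apsi a b c d; rewrite lie_psiE T1 T2 T3 T4 !dotNr.
by rewrite !(stab_quadratic Apsi) aa bb cc dd; lra.
Qed.

Lemma stab_skew u v : dot (A *m u) v = - dot u (A *m v).
Proof.
by rewrite dot_trmx (stab_trmx Apsi) stab_trace0 mulr0 mulmxBl dotDr dotNr
  mul_scalar_mx scale0r -[X in dot u X](scale0r 0) dotZr mul0r add0r.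
Qed.

Lemma stab_quadratic0 u : dot (A *m u) u = 0.
Proof. by rewrite (stab_quadratic Apsi) stab_trace0 mul0r. Qed.

Lemma lie_omega_repeat a b : lie_omega A a a b = 0.
Proof. by have := lie_omega_swap a a b; lra. Qed.

Lemma lie_omega_line a b : dot a a = 1 -> dot b b = 1 -> dot a b = 0 ->
  lie_omega A a b (cross a b) = 0.
Proof.
move=> aa bb ab; rewrite /lie_omega.
rewrite (omega_cyc a (A *m b)) -(omega_cyc (A *m cross a b)).
rewrite /omega_tilde !dot_cross_cyc.
have -> : cross b (cross a b) = a.
  by rewrite (crossC a) crossNr cross_crossvv dotC ab bb scale0r scale1r sub0r opprK.
have -> : cross (cross a b) a = b.
  by rewrite crossC cross_crossvv ab aa scale0r scale1r sub0r opprK.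
by rewrite !stab_quadratic0 !addr0.
Qed.

(** With d = a x (b x c) the three terms of [lie_omega] are <A a, d x a>,
    <A b, d x b> and <A c, d x c>; by skewness this is [stab_line] for a, b, d. *)
Lemma lie_omega_triple a b c : dot a a = 1 -> dot b b = 1 -> dot c c = 1 ->
  dot a b = 0 -> dot a c = 0 -> dot b c = 0 -> dot (cross a b) c = 0 ->
  lie_omega A a b c = 0.
Proof.
move=> aa bb cc ab ac bc abc.
have := triple_facts aa bb cc ab ac bc abc; set d := cross a _.
move=> [da db dc [dd ad bd cd]].
have da0 : dot d a = 0 by rewrite dotC.
have db0 : dot d b = 0 by rewrite dotC.
have dz : dot d (cross a b) = 0 by rewrite -dc dot_crossl.
have := stab_line Apsi ab da0 db0 dz; rewrite aa bb !mul1r da db.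
have -> : cross d (cross a b) = - c.
  by rewrite -dc cross_crossvv dotC cd dd scale0r scale1r sub0r.
rewrite dotNr (stab_skew (cross a b)) opprK => E.
rewrite /lie_omega (omega_cyc a (A *m b)) -(omega_cyc (A *m c)).
by rewrite /omega_tilde !dot_cross_cyc (dotC (A *m c)).
Qed.

(** On basis vectors the triple is degenerate, or general, or a line of the Fano
    plane with e_k = e_i x e_j up to sign. *)
Lemma stab_omega u v w : lie_omega A u v w = 0.
Proof.
move: u v w; apply: lie_omega_basis => i j k.
have [<-|ij] := eqVneq i j; first exact: lie_omega_repeat.
have [<-|jk] := eqVneq j k; first by rewrite lie_omega_cyc lie_omega_repeat.
have [<-|ik] := eqVneq i k; first by rewrite -lie_omega_cyc lie_omega_repeat.
have ii l : dot (e l) (e l) = 1 by rewrite dot_deltas eqxx.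
have oij : dot (e i) (e j) = 0 by rewrite dot_deltas (negPf ij).
have ojk : dot (e j) (e k) = 0 by rewrite dot_deltas (negPf jk).
have oik : dot (e i) (e k) = 0 by rewrite dot_deltas (negPf ik).
have zz : dot (cross (e i) (e j)) (cross (e i) (e j)) = 1.
  by rewrite dot_cross_cross !ii oij expr0n subr0 mul1r.
have [s0|s0] := eqVneq (dot (cross (e i) (e j)) (e k)) 0.
  exact: lie_omega_triple.
pose s := dot (cross (e i) (e j)) (e k).
have s2 : s * s = 1.
  move: s0; rewrite /s dot_delta cross_delta /epsilon.
  case: ifP => _; first by rewrite mulr1.
  by case: ifP => _; rewrite ?mulrNN ?mulr1 ?mulr0 ?eqxx.
have -> : e k = s *: cross (e i) (e j).
  apply/eqP; rewrite -subr_eq0; apply/eqP; set z := _ - _.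
  have : dot z z = 0 by rewrite /z !dotE ii zz (dotC (e k)) -/s; lra.
  exact: dot_eq0.
by rewrite 2!lie_omega_cyc lie_omegaZ -2!lie_omega_cyc lie_omega_line // mulr0.
Qed.

End Stab.

End Annihilator.

(** * The matrix exponential *)

Section MatrixExp.
Context {R : realType}.
Implicit Types (A : 'M[R]_7) (t x : R).

Lemma is_cvg_pseries_geom (a : nat -> R) (K x : R) : 0 <= K ->
  (forall k, `|a k| <= K ^+ k.+1) -> cvgn (pseries (fun k => k`!%:R^-1 * a k) x).
Proof.
move=> K0 aK; apply: normed_cvg.
apply: (@series_le_cvg _ _ (K *: exp_coeff (K * `|x|))) => /= [k|k|k|].
- exact: normr_ge0.
- rewrite /exp_coeff /= mulr_ge0 // divr_ge0 ?exprn_ge0 ?mulr_ge0 //.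
- rewrite [leRHS](_ : _ = k`!%:R^-1 * (K ^+ k.+1) * `|x| ^+ k); last first.
    by rewrite -[LHS]/(K * ((K * `|x|) ^+ k / k`!%:R)) exprMn exprS; ring.
  rewrite !normrM normrX normfV normr_nat.
  by rewrite ler_wpM2r ?exprn_ge0 // ler_wpM2l ?invr_ge0.
exact/is_cvg_seriesZ/is_cvg_series_exp_coeff.
Qed.

Lemma mx_pow_bound A : exists2 K : R, 0 <= K &
  forall k i j, `|(A ^+ k) i j| <= K ^+ k.
Proof.
pose M := \sum_i \sum_j `|A i j|; exists (7 * M).
  by rewrite mulr_ge0 // !sumr_ge0 // => i _; rewrite sumr_ge0.
have M0 : 0 <= M by rewrite !sumr_ge0 // => i _; rewrite sumr_ge0.
have AM i j : `|A i j| <= M.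
  rewrite /M (bigD1 i) //= (bigD1 j) //= -addrA lerDl.
  by rewrite addr_ge0 // sumr_ge0 // => k _; rewrite ?sumr_ge0.
elim=> [|k IH] i j.
  by rewrite !expr0 mxE; case: (_ == _); rewrite ?normr1 ?normr0 ?ler01.
rewrite exprS mxE (le_trans (ler_norm_sum _ _ _)) //.
apply: (@le_trans _ _ (\sum_(l < 7) M * (7 * M) ^+ k)).
  by apply: ler_sum => l _; rewrite normrM ler_pM.
by rewrite sumr_const card_ord -[leLHS]mulr_natl mulrA exprS.
Qed.

(** Each entry of exp(t A) is a power series in t with these coefficients. *)
Definition exp_coef A (i j : 'I_7) (k : nat) : R := k`!%:R^-1 * (A ^+ k) i j.

(** The shift by m covers the derived series needed for termwise
    differentiation. *)
Lemma is_cvg_exp_coef_shift A m i j x :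
  cvgn (pseries (fun k => k`!%:R^-1 * (A ^+ (k + m)) i j) x).
Proof.
have [K K0 HK] := mx_pow_bound A.
apply: (@is_cvg_pseries_geom _ ((1 + K) ^+ m.+1)) => [|k].
  by rewrite exprn_ge0 // addr_ge0.
apply: (le_trans (HK _ _ _)).
apply: (@le_trans _ _ ((1 + K) ^+ (k + m))).
  by rewrite lerXn2r ?nnegrE ?addr_ge0 // lerDr.
rewrite -exprM ler_weXn2l ?lerDl //.
by rewrite mulnS mulSn addnC leq_add // leq_addr.
Qed.

Lemma exp_coef_diffs A i j :
  pseries_diffs (exp_coef A i j) = fun k => k`!%:R^-1 * (A ^+ k.+1) i j.
Proof.
apply/funext => k; rewrite /pseries_diffs /exp_coef mulrA; congr (_ * _).
rewrite factS natrM invfM mulrA divff ?mul1r // pnatr_eq0 //.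
Qed.

Lemma cvg_sum_ord n (f : 'I_n -> nat -> R) (l : 'I_n -> R) :
  (forall i, f i k @[k --> \oo] --> l i) ->
  (\sum_i f i k) @[k --> \oo] --> \sum_i l i.
Proof.
move=> fl; rewrite (_ : (fun k => _) = \sum_i f i); last first.
  by apply/funext => k; rewrite fct_sumE.
by apply: (big_ind2 (fun (g : nat -> R) m => g @ \oo --> m)) => [|? ? ? ? ? ?|i _];
  [exact: cvg_cst|exact: cvgD|exact: fl].
Qed.

Lemma cvg_exp_coef A i j x : cvgn (pseries (exp_coef A i j) x).
Proof.
by have := @is_cvg_exp_coef_shift A 0 i j x; under eq_fun do rewrite addn0.
Qed.

Lemma expmxE A t i j : expmx (t *: A) i j = limn (pseries (exp_coef A i j) t).
Proof.
rewrite /expmx; set s := series _.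
suff sl : s @ \oo --> (\matrix_(i, j) limn (pseries (exp_coef A i j) t) : 'M[R]_7).
  by rewrite (cvg_lim _ sl) ?mxE.
have sE n i' j' : s n i' j' = pseries (exp_coef A i' j') t n.
  rewrite /s /pseries /series /= summxE; apply: eq_bigr => k _.
  by rewrite mxE exprZn mxE /exp_coef; ring.
apply/cvgrPdist_le => /= eps e0; near=> n.
rewrite /Num.Def.normr/= mx_normrE (bigmax_le _ (ltW e0))//= => k _.
rewrite !mxE sE.
move: k; near: n; apply: filter_forall => -[i' j'] /=.
by have /cvgrPdist_le/(_ _ e0) := @cvg_exp_coef A i' j' t.
Unshelve. all: by end_near. Qed.

Lemma expmx0 A : expmx (0 *: A) = 1.
Proof.
apply/matrixP => i j; rewrite expmxE -[RHS]mul1r.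
have -> : pseries (exp_coef A i j) 0 = fun n => (n != 0%N)%:R * (1 : 'M[R]_7) i j.
  apply/funext => -[|n]; rewrite /pseries /series /=; first by rewrite big_geq // mul0r.
  rewrite big_nat_recl // big1 ?addr0 => [|k _]; last by rewrite exprS mul0r mulr0.
  by rewrite /exp_coef invr1 !mul1r expr0 mulr1.
apply/cvg_lim => //; apply: cvgMr_tmp; apply: cvg_near_cst.
by exists 1%N => // -[].
Qed.

Lemma is_derive_expmx A t i j :
  is_derive t (1 : R) (fun s : R => expmx (s *: A) i j) ((A *m expmx (t *: A)) i j).
Proof.
under eq_fun do rewrite expmxE.
have -> : (A *m expmx (t *: A)) i j = limn (pseries (pseries_diffs (exp_coef A i j)) t).
  rewrite mxE; apply/esym/cvg_lim => //; under eq_bigr do rewrite expmxE.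
  have -> : pseries (pseries_diffs (exp_coef A i j)) t =
      fun n => \sum_k A i k * pseries (exp_coef A k j) t n.
    apply/funext => n; rewrite exp_coef_diffs /pseries /series /=.
    under [RHS]eq_bigr do rewrite mulr_sumr.
    rewrite exchange_big; apply: eq_bigr => k _.
    rewrite exprS mxE mulr_sumr mulr_suml; apply: eq_bigr => l _.
    by rewrite /exp_coef; ring.
  by apply: cvg_sum_ord => k; apply: cvgMl_tmp; apply: cvg_exp_coef.
have C m x : cvgn (pseries (fun k => k`!%:R^-1 * (A ^+ (k + m)) i j) x).
  exact: is_cvg_exp_coef_shift.
apply: (@pseries_snd_diffs _ _ (`|t| + 1)).
- exact: cvg_exp_coef.
- by rewrite exp_coef_diffs; have := C 1%N (`|t| + 1); under eq_fun do rewrite addn1.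
- have -> : pseries_diffs (pseries_diffs (exp_coef A i j)) =
      fun k => k`!%:R^-1 * (A ^+ (k + 2)) i j; last exact: C.
  apply/funext => k; rewrite exp_coef_diffs addn2 /pseries_diffs mulrA; congr (_ * _).
  by rewrite factS natrM invfM mulrA divff ?mul1r // pnatr_eq0.
- by rewrite [ltRHS]ger0_norm ?addr_ge0 // ltrDl.
Qed.

End MatrixExp.

(** * Derivatives of vector expressions *)

Section VectorDerive.
Context {R : realType} {V : normedModType R}.
Implicit Types (x v : V).

Lemma is_derive_mxP m n (F : V -> 'M[R]_(m.+1, n.+1)) x v dF :
  is_derive x v F dF <-> forall i j, is_derive x v (fun y => F y i j : R) (dF i j).
Proof.
split=> [FdF i j|FdF].
  have Fd : derivable F x v by case: FdF.
  split; first exact: (derivable_mxP F x v).1.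
  by rewrite -[dF](@derive_val _ _ _ _ _ F) derive_mx // mxE.
have Fd : derivable F x v by apply/derivable_mxP => i j; case: (FdF i j).
split=> //; rewrite derive_mx //; apply/matrixP => i j; rewrite mxE.
exact: derive_val.
Qed.

Lemma is_derive_conv (W : normedModType R) (f g : V -> W) x v df dg :
  is_derive x v f df -> f =1 g -> df = dg -> is_derive x v g dg.
Proof. by move=> D /funext <- <-. Qed.

Lemma is_derive_mul (f g : V -> R) x v df dg :
  is_derive x v f df -> is_derive x v g dg ->
  is_derive x v (fun y => f y * g y) (df * g x + f x * dg).
Proof.
move=> fdf gdg; apply: (is_derive_conv (is_deriveM fdf gdg)) => //.
by rewrite /GRing.scale /=; ring.
Qed.

Lemma is_derive_sumf n (h : 'I_n -> V -> R) x v (dh : 'I_n -> R) :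
  (forall i, is_derive x v (h i) (dh i)) ->
  is_derive x v (fun y => \sum_i h i y) (\sum_i dh i).
Proof.
move=> hd; rewrite (_ : (fun y => _) = \sum_i h i).
  exact: is_derive_sum.
by apply/funext => y; rewrite fct_sumE.
Qed.

Lemma is_derive_dot n (F G : V -> 'cV[R]_n.+1) x v dF dG :
  is_derive x v F dF -> is_derive x v G dG ->
  is_derive x v (fun y => dot (F y) (G y) : R) (dot dF (G x) + dot (F x) dG).
Proof.
move=> /is_derive_mxP FdF /is_derive_mxP GdG; rewrite /dot -big_split.
by apply: is_derive_sumf => i; apply: is_derive_mul.
Qed.

Lemma is_derive_mulmx m n p (F : V -> 'M[R]_(m.+1, n.+1))
    (G : V -> 'M[R]_(n.+1, p.+1)) x v dF dG :
  is_derive x v F dF -> is_derive x v G dG ->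
  is_derive x v (fun y => F y *m G y) (dF *m G x + F x *m dG).
Proof.
move=> /is_derive_mxP FdF /is_derive_mxP GdG; apply/is_derive_mxP => i j.
rewrite !mxE -big_split; under eq_fun do rewrite mxE.
by apply: is_derive_sumf => k; apply: is_derive_mul.
Qed.

Lemma cross_sum (a b : 'cV[R]_7) k : cross a b k 0 =
  \sum_i \sum_j a i 0 * b j 0 * (epsilon i.+1 j.+1 k.+1)%:~R.
Proof.
rewrite cross_coord !oct_mul_imS [X in _ - X]exchange_big -sumrB mulr_sumr.
apply: eq_bigr => i _; rewrite -sumrB mulr_sumr; apply: eq_bigr => j _.
by rewrite (epsilon_anti i j) mulrNz; lra.
Qed.

Lemma is_derive_cross (F G : V -> 'cV[R]_7) x v dF dG :
  is_derive x v F dF -> is_derive x v G dG ->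
  is_derive x v (fun y => cross (F y) (G y)) (cross dF (G x) + cross (F x) dG).
Proof.
move=> /is_derive_mxP FdF /is_derive_mxP GdG; apply/is_derive_mxP => k j.
rewrite (ord1 j) coordE !cross_sum -big_split; under eq_fun do rewrite cross_sum.
apply: is_derive_sumf => i; rewrite -big_split; apply: is_derive_sumf => l.
apply: (is_derive_conv (is_derive_mul (is_derive_mul (FdF i 0) (GdG l 0))
  (is_derive_cst ((epsilon i.+1 l.+1 k.+1)%:~R : R) x v))) => //.
by rewrite /=; ring.
Qed.

Lemma is_derive_omega (F G H : V -> 'cV[R]_7) x v dF dG dH :
  is_derive x v F dF -> is_derive x v G dG -> is_derive x v H dH ->
  is_derive x v (fun y => omega_tilde (F y) (G y) (H y) : R)
   (omega_tilde dF (G x) (H x) + omega_tilde (F x) dG (H x) + omega_tilde (F x) (G x) dH).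
Proof.
move=> FdF GdG HdH.
apply: (is_derive_conv (is_derive_dot (is_derive_cross FdF GdG) HdH)) => //.
by rewrite dotDl.
Qed.

Lemma is_derive_psi (F G H K : V -> 'cV[R]_7) x v dF dG dH dK :
  is_derive x v F dF -> is_derive x v G dG -> is_derive x v H dH ->
  is_derive x v K dK ->
  is_derive x v (fun y => psi (F y) (G y) (H y) (K y) : R)
   (psi dF (G x) (H x) (K x) + psi (F x) dG (H x) (K x)
    + psi (F x) (G x) dH (K x) + psi (F x) (G x) (H x) dK).
Proof.
move=> FdF GdG HdH KdK.
have D1 := is_derive_dot (is_derive_cross FdF GdG) (is_derive_cross HdH KdK).
have D2 := is_derive_mul (is_derive_dot FdF HdH) (is_derive_dot GdG KdK).
have D3 := is_derive_mul (is_derive_dot FdF KdK) (is_derive_dot GdG HdH).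
apply: (is_derive_conv (is_deriveD (is_deriveB D1 D2) D3)) => //.
by rewrite /psi !dotDl !dotDr; ring.
Qed.

End VectorDerive.

(** * G_2 and its Lie algebra *)

Section ExpAction.
Context {R : realType}.
Implicit Types (A xi : 'M[R]_7) (t : R) (u v w p : 'cV[R]_7).

Lemma is_derive_expmx_vec A t u :
  is_derive t (1 : R) (fun s : R => expmx (s *: A) *m u) (A *m (expmx (t *: A) *m u)).
Proof.
have E : is_derive t (1 : R) (fun s : R => expmx (s *: A)) (A *m expmx (t *: A)).
  by apply/is_derive_mxP => i j; exact: is_derive_expmx.
apply: (is_derive_conv (is_derive_mulmx E (is_derive_cst u t 1))) => //.
by rewrite mulmx0 addr0 mulmxA.
Qed.

Lemma fundamental_fieldE xi p : fundamental_field xi p = xi *m p.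
Proof.
rewrite /fundamental_field derive1E.
have D := is_derive_expmx_vec xi 0 p.
by rewrite (@derive_val _ _ _ _ _ _ _ D) expmx0 mul1mx.
Qed.

Lemma is_derive_omega_exp A t u v w :
  is_derive t (1 : R) (fun s : R => omega_tilde (expmx (s *: A) *m u)
     (expmx (s *: A) *m v) (expmx (s *: A) *m w))
   (lie_omega A (expmx (t *: A) *m u) (expmx (t *: A) *m v) (expmx (t *: A) *m w)).
Proof.
exact: (is_derive_omega (is_derive_expmx_vec A t u) (is_derive_expmx_vec A t v)
  (is_derive_expmx_vec A t w)).
Qed.

End ExpAction.

Section G2.
Context {R : realType}.
Implicit Types (A xi g : 'M[R]_7) (t : R) (u v w p : 'cV[R]_7) (x y z : octonion R).

Lemma oct_mul_linear_l (k : R) x y z :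
  oct_mul (k *: x + y) z = k *: oct_mul x z + oct_mul y z.
Proof.
rewrite /oct_mul scaler_sumr -big_split; apply: eq_bigr => i _.
rewrite scaler_sumr -big_split; apply: eq_bigr => j _.
have -> : (k *: x + y) i 0 = k * x i 0 + y i 0 by rewrite !mxE.
by rewrite /= scalerA -scalerDl mulrDl mulrA.
Qed.

Lemma oct_mul_linear_r (k : R) x y z :
  oct_mul z (k *: x + y) = k *: oct_mul z x + oct_mul z y.
Proof.
rewrite /oct_mul scaler_sumr -big_split; apply: eq_bigr => i _.
rewrite scaler_sumr -big_split; apply: eq_bigr => j _.
have -> : (k *: x + y) j 0 = k * x j 0 + y j 0 by rewrite !mxE.
by rewrite /= scalerA -scalerDl mulrDr mulrCA.
Qed.

Lemma oct_sum_e x : x = \sum_(j < 8) x j 0 *: oct_e R j.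
Proof.
rewrite {1}[x]matrix_sum_delta; apply: eq_bigr => j _.
by rewrite big_ord1.
Qed.

Lemma oct_mul1l x : oct_mul (oct_e R ord0) x = x.
Proof.
rewrite /oct_mul (bigD1 ord0) //= [X in _ + X]big1 ?addr0 => [|i i0].
  rewrite [RHS]oct_sum_e; apply: eq_bigr => j _.
  by rewrite /oct_e_mul eqxx mxE eqxx mul1r.
by apply: big1 => j _; rewrite mxE (negPf i0) mul0r scale0r.
Qed.

Lemma oct_mul1r x : oct_mul x (oct_e R ord0) = x.
Proof.
rewrite /oct_mul exchange_big (bigD1 ord0) //= [X in _ + X]big1 ?addr0 => [|i i0].
  rewrite [RHS]oct_sum_e; apply: eq_bigr => j _.
  rewrite /oct_e_mul mxE eqxx mulr1; case: eqP => [->|] //.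
by apply: big1 => j _; rewrite mxE (negPf i0) mulr0 scale0r.
Qed.

Lemma octE : (forall x y i, (x + y) i 0 = x i 0 + y i 0) *
  (forall k x i, (k *: x) i 0 = k * x i 0) *
  (oct_e R ord0 ord0 0 = 1) * (forall i, oct_e R ord0 (lift ord0 i) 0 = 0).
Proof. by do ![split] => *; rewrite !mxE. Qed.

Lemma oct_mul_im u v :
  oct_mul (im_oct u) (im_oct v) = (- dot u v) *: oct_e R ord0 + im_oct (cross u v).
Proof.
apply/colP => i; case: (unliftP ord0 i) => [j ->|->].
  by rewrite oct_mul_imS -cross_sum !octE im_octS mulr0 add0r.
by rewrite oct_mul_im0 !octE im_oct0 addr0 mulr1.
Qed.

Lemma oct_split x : exists (a : R) (u : 'cV[R]_7), x = a *: oct_e R ord0 + im_oct u.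
Proof.
exists (x ord0 0), (\col_i x (lift ord0 i) 0); apply/colP => i.
case: (unliftP ord0 i) => [j ->|->].
  by rewrite !octE im_octS mxE mulr0 add0r.
by rewrite !octE im_oct0 addr0 mulr1.
Qed.

Lemma im_oct_inj u v : im_oct u = im_oct v -> u = v.
Proof. by move=> uv; apply/colP => i; rewrite -!im_octS uv. Qed.

(** An automorphism preserves the real and the imaginary part of the product of
    two imaginary octonions, which are - <u,v> and u x v. *)
Lemma G2P g : G2 g <-> (forall u v, dot (g *m u) (g *m v) = dot u v) /\
   (forall u v, g *m cross u v = cross (g *m u) (g *m v)).
Proof.
split=> [[f [[_ f1 fM] fg]]|[gdot gcross]].
  have E u v : (- dot u v) *: oct_e R ord0 + im_oct (g *m cross u v) =
      (- dot (g *m u) (g *m v)) *: oct_e R ord0 + im_oct (cross (g *m u) (g *m v)).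
    by rewrite -oct_mul_im -!fg -fM oct_mul_im linearP /= f1 fg.
  have D u v : dot (g *m u) (g *m v) = dot u v.
    have /colP/(_ ord0) := E u v.
    by rewrite !octE !im_oct0 !addr0 !mulr1 => /oppr_inj ->.
  split=> // u v; apply: im_oct_inj; have := E u v; rewrite D.
  exact: addrI.
have gTg : g^T *m g = 1%:M.
  apply/matrixP => i j; rewrite -mul_delta -mulmxA dot_trmx trmxK gdot.
  by rewrite dot_deltas mxE eq_sym.
pose M : 'M[R]_(1 + 7) := block_mx 1%:M 0 0 g.
pose M' : 'M[R]_(1 + 7) := block_mx 1%:M 0 0 g^T.
have MM : M' *m M = 1%:M.
  by rewrite mulmx_block !mulmx0 !mul0mx !addr0 add0r mulmx1 gTg -scalar_mx_block.
have MM' : M *m M' = 1%:M := mulmx1C MM.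
have Mim u : M *m im_oct u = im_oct (g *m u).
  by rewrite /im_oct mul_block_col mulmx0 !mul0mx !add0r.
have M1 : M *m oct_e R ord0 = oct_e R ord0.
  have -> : oct_e R ord0 = col_mx 1%:M 0 :> 'cV[R]_(1 + 7).
    apply/colP => i; rewrite mxE eqxx andbT; case: (split_ordP i) => k ->.
      by rewrite (ord1 k) col_mxEu mxE.
    by rewrite col_mxEd mxE.
  by rewrite mul_block_col !mulmx0 mul0mx mulmx1 !addr0.
pose f : {linear octonion R -> octonion R} := mulmx M.
exists f; split=> [|u]; last exact: Mim.
split=> [|//|x y].
  by exists (mulmx M') => z; rewrite /= mulmxA ?MM ?MM' mul1mx.
have [a [u ->]] := oct_split x; have [b [v ->]] := oct_split y.
rewrite /= mulmxDr -scalemxAr M1 Mim [M *m (b *: _ + _)]mulmxDr -scalemxAr M1 Mim.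
rewrite !(oct_mul_linear_l, oct_mul_linear_r) !oct_mul1l !oct_mul1r.
rewrite !oct_mul_im gdot -gcross.
rewrite mulmxDr -scalemxAr mulmxDr -scalemxAr mulmxDr -scalemxAr mulmxDr -scalemxAr.
by rewrite M1 !Mim.
Qed.

Lemma g2_lie_omega xi : g2 xi -> forall u v w, lie_omega xi u v w = 0.
Proof.
move=> gxi u v w; have := is_derive_omega_exp xi 0 u v w.
rewrite expmx0 !mul1mx => D; rewrite -(@derive_val _ _ _ _ _ _ _ D).
rewrite (_ : (fun s : R => _) = cst (omega_tilde u v w)) ?derive_cst //.
apply/funext => t; have /G2P[gdot gcross] := gxi t.
by rewrite /omega_tilde -gcross gdot.
Qed.

Lemma lie_omega_g2 xi : (forall u v, dot (xi *m u) v = - dot u (xi *m v)) ->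
  (forall u v w, lie_omega xi u v w = 0) -> g2 xi.
Proof.
move=> skew xi0 t; apply/G2P.
have gdot s u v : dot (expmx (s *: xi) *m u) (expmx (s *: xi) *m v) = dot u v.
  have : forall x : R, is_derive x (1 : R)
      (fun s : R => dot (expmx (s *: xi) *m u) (expmx (s *: xi) *m v)) 0.
    move=> x; apply: (is_derive_conv (is_derive_dot (is_derive_expmx_vec xi x u)
      (is_derive_expmx_vec xi x v))) => //.
    by rewrite skew addNr.
  by move=> H; rewrite (@is_derive_0_is_cst _ _ s 0 H); rewrite expmx0 !mul1mx.
have gomega s u v w : omega_tilde (expmx (s *: xi) *m u) (expmx (s *: xi) *m v)
    (expmx (s *: xi) *m w) = omega_tilde u v w.
  have : forall x : R, is_derive x (1 : R) (fun s : R =>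
      omega_tilde (expmx (s *: xi) *m u) (expmx (s *: xi) *m v) (expmx (s *: xi) *m w)) 0.
    by move=> x; apply: (is_derive_conv (is_derive_omega_exp xi x u v w)).
  by move=> H; rewrite (@is_derive_0_is_cst _ _ s 0 H); rewrite expmx0 !mul1mx.
split=> [u v|u v]; first exact: gdot.
move: gdot gomega => /(_ t) gdot /(_ t) gomega; set g := expmx _ in gdot gomega *.
apply: dot_inj => w.
have gTg : g^T *m g = 1%:M.
  apply/matrixP => i j; rewrite -mul_delta -mulmxA dot_trmx trmxK gdot.
  by rewrite dot_deltas mxE eq_sym.
have -> : w = g *m (g^T *m w) by rewrite mulmxA (mulmx1C gTg) mul1mx.
by rewrite gdot; exact/esym/gomega.
Qed.

End G2.

(** * Smooth functions *)

Section Smooth.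
Context {R : realType} {V : normedModType R}.
Implicit Types (f g : V -> R^o) (x u v : V).

Lemma CkW (W : normedModType R) k (f : V -> W) : Ck k.+1 f -> Ck k f.
Proof.
elim: k f => [|k IH] f [fd fD]; first by move=> x; exact: differentiable_continuous.
by split=> // v; apply: IH; exact: fD.
Qed.

Lemma eq_Ck (W : normedModType R) k (f g : V -> W) : f =1 g -> Ck k f -> Ck k g.
Proof. by move=> /funext ->. Qed.

Lemma Ck_cst k (c : R) : Ck k (fun _ : V => c : R^o).
Proof.
elim: k c => [|k IH] c /=; first exact: cst_continuous.
split=> [x|v]; first exact: differentiable_cst.
by apply: eq_Ck (IH 0) => x; rewrite derive_cst.
Qed.

Lemma CkD k f g : Ck k f -> Ck k g -> Ck k (fun y => f y + g y : R^o).
Proof.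
elim: k f g => [|k IH] f g /=.
  by move=> fc gc x; apply: cvgD; [exact: fc|exact: gc].
move=> [fd fD] [gd gD]; split=> [x|v]; first exact: differentiableD.
apply: eq_Ck (IH _ _ (fD v) (gD v)) => x /=.
by rewrite deriveD //; exact: diff_derivable.
Qed.

Lemma derive_mul f g x v : differentiable f x -> differentiable g x ->
  'D_v (fun y => f y * g y : R^o) x = 'D_v f x * g x + f x * 'D_v g x.
Proof.
move=> fd gd; have F := derivableP (diff_derivable (v := v) fd).
have G := derivableP (diff_derivable (v := v) gd).
have D := is_derive_mul F G; exact: (@derive_val _ _ _ _ _ _ _ D).
Qed.

Lemma CkM k f g : Ck k f -> Ck k g -> Ck k (fun y => f y * g y : R^o).
Proof.
elim: k f g => [|k IH] f g.
  by move=> fc gc x; apply: cvgM; [exact: fc|exact: gc].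
move=> fC gC; have [fd fD] := fC; have [gd gD] := gC.
split=> [x|v]; first exact: differentiableM.
apply: eq_Ck (CkD (IH _ _ (fD v) (CkW gC)) (IH _ _ (CkW fC) (gD v))) => x.
by rewrite derive_mul.
Qed.

Lemma CkV k f : (forall y, f y != 0) -> Ck k f -> Ck k (fun y => (f y)^-1 : R^o).
Proof.
move=> f0; elim: k => [|k IH]; first by move=> fc x; apply: cvgV => //; exact: fc.
move=> fC; have [fd fD] := fC; split=> [x|v]; first exact: differentiableV.
have IHk := IH (CkW fC).
apply: eq_Ck (CkM (Ck_cst k (-1)) (CkM (fD v) (CkM IHk IHk))) => x.
rewrite deriveV //; last exact: diff_derivable.
by rewrite /GRing.scale /= expr2 invfM; ring.
Qed.

Lemma smooth_cst (c : R) : smooth (fun _ : V => c : R^o).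
Proof. by move=> k; exact: Ck_cst. Qed.

Lemma smoothD f g : smooth f -> smooth g -> smooth (fun y => f y + g y : R^o).
Proof. by move=> fs gs k; exact: CkD. Qed.

Lemma smoothM f g : smooth f -> smooth g -> smooth (fun y => f y * g y : R^o).
Proof. by move=> fs gs k; exact: CkM. Qed.

Lemma smoothV f : (forall y, f y != 0) -> smooth f -> smooth (fun y => (f y)^-1 : R^o).
Proof. by move=> f0 fs k; exact: CkV. Qed.

Lemma smooth_sum n (h : 'I_n -> V -> R^o) : (forall i, smooth (h i)) ->
  smooth (fun y => \sum_i h i y : R^o).
Proof.
elim: n h => [|n IH] h hs k.
  by apply: eq_Ck (Ck_cst k 0) => x; rewrite big_ord0.
apply: eq_Ck (CkD (hs ord0 k) (IH (fun i => h (lift ord0 i)) _ k)) => // x.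
by rewrite big_ord_recl.
Qed.

Lemma smooth_D f v : smooth f -> smooth (fun y => 'D_v f y : R^o).
Proof. by move=> fs k; have [_] := fs k.+1; exact. Qed.

Lemma smooth_diff f x : smooth f -> differentiable f x.
Proof. by move=> fs; have [+ _] := fs 1%N; exact. Qed.

Lemma eq_smooth f g : f =1 g -> smooth f -> smooth g.
Proof. by move=> /funext ->. Qed.

Lemma is_derive_line f x v (t : R) : derivable f (x + t *: v) v ->
  is_derive t (1 : R) (fun s : R => f (x + s *: v)) ('D_v f (x + t *: v)).
Proof.
have E : (fun h : R => h^-1 *: (f (x + (h *: (1 : R) + t) *: v) - f (x + t *: v))) =
         (fun h : R => h^-1 *: (f (h *: v + (x + t *: v)) - f (x + t *: v))).
  apply/funext => h; congr (_ *: (f _ - _)).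
  by rewrite [h *: (1 : R)]mulr1 scalerDl addrCA.
by move=> fd; split; rewrite /derivable /derive /= E.
Qed.

Lemma MVT_line f x v (h : R) : 0 < h -> (forall y, derivable f y v) ->
  exists2 s : R, 0 < s < h & f (x + h *: v) - f x = 'D_v f (x + s *: v) * h.
Proof.
move=> h0 fd.
have D (t : R) := is_derive_line (fd (x + t *: v)).
have C : {within `[0, h], continuous (fun t : R => f (x + t *: v) : R)}.
  apply: continuous_subspaceT => t; apply: differentiable_continuous.
  by apply/derivable1_diffP; case: (D t).
have [t th E] := @MVT R _ (fun t => 'D_v f (x + t *: v)) 0 h h0 (fun t _ => D t) C.
exists t; first by rewrite in_itv /= in th.
by move: E; rewrite scale0r addr0 subr0.
Qed.

(** The second difference is an increment of g(y) = f(y + h v) - f(y) in the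
    direction u; the mean value theorem is used once for each direction. *)
Lemma second_difference f x u v (h : R) : 0 < h -> (forall y, derivable f y u) ->
  (forall y, derivable (fun z => 'D_u f z : R^o) y v) ->
  exists s t : R, [/\ 0 < s < h, 0 < t < h &
    f (x + h *: u + h *: v) - f (x + h *: u) - (f (x + h *: v) - f x) =
    'D_v (fun z => 'D_u f z : R^o) (x + s *: u + t *: v) * (h * h)].
Proof.
move=> h0 fu fuv; pose g y : R^o := f (y + h *: v) - f y.
have D y : is_derive y u g ('D_u f (y + h *: v) - 'D_u f y).
  apply: is_deriveB; last exact: derivableP.
  have E : (fun k : R => k^-1 *: (f (k *: u + (y + h *: v)) - f (y + h *: v))) =
           (fun k : R => k^-1 *: (f (k *: u + y + h *: v) - f (y + h *: v))).
    by apply/funext => k; rewrite addrA.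
  by split; rewrite /derivable /derive /= -E; [exact: fu|].
have gu y : derivable g y u by case: (D y).
have [s sh E1] := MVT_line x h0 gu.
have [t th E2] := MVT_line (x + s *: u) h0 fuv.
exists s, t; split=> //.
rewrite mulrA -E2 -(@derive_val _ _ _ _ _ _ _ (D _)) -E1 /g.
by rewrite (addrAC x).
Qed.

Lemma dist_half (a b m e : R) : `|b - m| < e / 2 -> `|a - m| < e / 2 -> `|a - b| < e.
Proof.
move=> bm am; rewrite (splitr e); apply: le_lt_trans (ler_distD m a b) _.
by rewrite ltrD // distrC.
Qed.

(** Schwarz's theorem: the second difference of [second_difference] is symmetric
    in u and v, so both mixed derivatives take a common value near x. *)
Lemma derive_comm f x u v : smooth f ->
  'D_v (fun z => 'D_u f z : R^o) x = 'D_u (fun z => 'D_v f z : R^o) x.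
Proof.
move=> fs; apply/eqP; rewrite -subr_eq0 -normr_le0; apply/ler_addgt0Pl => e e0.
rewrite addr0.
have der w y : derivable f y w by apply: diff_derivable; exact: smooth_diff.
have der2 w w' y : derivable (fun z => 'D_w f z : R^o) y w'.
  by apply: diff_derivable; apply: smooth_diff; exact: smooth_D.
have cont w w' : {for x, continuous (fun y => 'D_w' (fun z => 'D_w f z : R^o) y : R)}.
  by apply: differentiable_continuous; apply: smooth_diff; do 2!apply: smooth_D.
have e2 : 0 < e / 2 by rewrite divr_gt0.
have /cvgrPdist_lt/(_ _ e2) := cont u v; have /cvgrPdist_lt/(_ _ e2) := cont v u.
move=> /nbhs_ballP[r1 /= r10 H1] /nbhs_ballP[r2 /= r20 H2].
pose r := Num.min r1 r2; have r0 : 0 < r by rewrite lt_min r10 r20.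
pose h := r / (`|u| + `|v| + 1).
have N0 : 0 < `|u| + `|v| + 1 by rewrite ltr_wpDl // addr_ge0.
have h0 : 0 < h by rewrite divr_gt0.
have near_x w w' (s t : R) : `|w| + `|w'| = `|u| + `|v| -> 0 < s < h -> 0 < t < h ->
    `|x - (x + s *: w + t *: w')| < r.
  move=> ww /andP[s0 sh] /andP[t0 th].
  rewrite -addrA opprD addrA subrr sub0r normrN.
  rewrite (le_lt_trans (ler_normD _ _)) // !normrZ !gtr0_norm //.
  apply: (@le_lt_trans _ _ (h * (`|w| + `|w'|))).
    by rewrite mulrDr lerD // ler_wpM2r // ltW.
  by rewrite ww /h mulrAC ltr_pdivrMr // ltr_pM2l // ltrDl.
have [s [t [sh th E]]] := second_difference x h0 (der u) (der2 u v).
have [s' [t' [sh' th' E']]] := second_difference x h0 (der v) (der2 v u).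
have EE : 'D_v (fun z => 'D_u f z : R^o) (x + s *: u + t *: v) =
          'D_u (fun z => 'D_v f z : R^o) (x + s' *: v + t' *: u).
  have hh : h * h != 0 by rewrite mulf_neq0 // gt_eqF.
  have cancel (a b : R) : a * (h * h) = b * (h * h) -> a = b by exact: mulIf.
  apply: cancel; apply: (etrans (esym E)); apply: etrans E'.
  rewrite (addrAC x (h *: v)).
  have swap (a b c d : R) : a - b - (c - d) = a - c - (b - d) by ring.
  exact: swap.
have B2 := near_x _ _ _ _ erefl sh th.
have B1 := near_x _ _ _ _ (addrC _ _) sh' th'.
have {}B2 : ball x r2 (x + s *: u + t *: v).
  by rewrite -ball_normE /=; apply: (lt_le_trans B2); rewrite /r ge_min lexx orbT.
have {}B1 : ball x r1 (x + s' *: v + t' *: u).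
  by rewrite -ball_normE /=; apply: (lt_le_trans B1); rewrite /r ge_min lexx.
have {B2}H2 := H2 _ B2; have {B1}H1 := H1 _ B1.
rewrite /= -EE in H1; rewrite /= in H2; apply: ltW.
exact: dist_half H1 H2.
Qed.

End Smooth.

Section EntrywiseSmooth.
Context {R : realType} {n : nat}.
Local Notation V := 'cV[R]_n.+1.

(** Matrix-valued maps are handled through their entries, so that only scalar
    functions need a calculus. *)
Definition csmooth m p (F : V -> 'M[R]_(m.+1, p.+1)) : Prop :=
  forall i j, smooth (fun y => F y i j : R^o).

Lemma csmooth_is_derive m p (F : V -> 'M[R]_(m.+1, p.+1)) y v :
  csmooth F -> is_derive y v F ('D_v F y).
Proof.
move=> Fs; apply: derivableP; apply/derivable_mxP => i j.
exact/diff_derivable/smooth_diff/Fs.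
Qed.

Lemma csmooth_deriveE m p (F : V -> 'M[R]_(m.+1, p.+1)) y v i j : csmooth F ->
  'D_v F y i j = 'D_v (fun y => F y i j : R^o) y.
Proof.
move=> Fs; have D := (is_derive_mxP _ _ _ _).1 (csmooth_is_derive y v Fs) i j.
by rewrite (@derive_val _ _ _ _ _ _ _ D).
Qed.

Lemma csmooth_D m p (F : V -> 'M[R]_(m.+1, p.+1)) v :
  csmooth F -> csmooth (fun y => 'D_v F y).
Proof.
move=> Fs i j; apply: (@eq_smooth _ _ (fun y => 'D_v (fun y => F y i j : R^o) y)).
  by move=> y; rewrite csmooth_deriveE.
exact/smooth_D/Fs.
Qed.

Lemma csmooth_derive_comm m p (F : V -> 'M[R]_(m.+1, p.+1)) y u v : csmooth F ->
  'D_v (fun z => 'D_u F z) y = 'D_u (fun z => 'D_v F z) y.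
Proof.
move=> Fs. apply/matrixP => i j.
have E w : (fun z => 'D_w F z i j : R^o) = fun z => 'D_w (fun y => F y i j : R^o) z.
  by apply/funext => z; rewrite csmooth_deriveE.
have Eu := csmooth_deriveE y v i j (csmooth_D u Fs).
have Ev := csmooth_deriveE y u i j (csmooth_D v Fs).
apply: (etrans Eu).
apply: (etrans _ (esym Ev)).
rewrite (E u).
rewrite (E v).
exact/derive_comm/Fs.
Qed.

Lemma derive_sum_basis (g : V -> R^o) y v : smooth g ->
  'D_v g y = \sum_k v k 0 * 'D_(delta_mx k 0) g y.
Proof.
move=> gs; have gd := smooth_diff y gs; rewrite deriveE //.
rewrite {1}[v]matrix_sum_delta linear_sum; apply: eq_bigr => k _.
by rewrite big_ord1 linearZ deriveE.
Qed.

Lemma csmooth_derive_sum m p (F : V -> 'M[R]_(m.+1, p.+1)) y v : csmooth F ->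
  'D_v F y = \sum_k v k 0 *: 'D_(delta_mx k 0) F y.
Proof.
move=> Fs; apply/matrixP => i j; rewrite csmooth_deriveE // derive_sum_basis //.
rewrite summxE; apply: eq_bigr => k _; rewrite mxE csmooth_deriveE //.
Qed.

Lemma smooth_csmooth m p (F : V -> 'M[R]_(m.+1, p.+1)) : smooth F -> csmooth F.
Proof.
move=> Fs i j k; move: (Fs k) => {Fs}; elim: k F => [|k IH] F /=.
  move=> Fc y; apply: (@continuous_comp _ _ _ F (fun M : 'M[R]_(m.+1, p.+1) => M i j)).
    exact: Fc.
  exact: coord_continuous.
move=> [Fd FD]; split=> [y|v].
  apply: (@differentiable_comp _ _ _ _ F (fun M : 'M[R]_(m.+1, p.+1) => M i j)) => //.
  exact: differentiable_coord.
apply: eq_Ck (IH _ (FD v)) => y /=.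
have D := (is_derive_mxP _ _ _ _).1 (derivableP (diff_derivable (v := v) (Fd y))) i j.
by rewrite (@derive_val _ _ _ _ _ _ _ D).
Qed.

Lemma csmooth_mulmx m p q (F : V -> 'M[R]_(m.+1, p.+1)) (G : V -> 'M[R]_(p.+1, q.+1)) :
  csmooth F -> csmooth G -> csmooth (fun y => F y *m G y).
Proof.
move=> Fs Gs i j; apply: (@eq_smooth _ _ (fun y => \sum_k F y i k * G y k j)).
  by move=> y; rewrite mxE.
by apply: smooth_sum => k; apply: smoothM.
Qed.

Lemma csmooth_cst m p (M : 'M[R]_(m.+1, p.+1)) : csmooth (fun _ => M).
Proof. by move=> i j; exact: smooth_cst. Qed.

Lemma csmoothD m p (F G : V -> 'M[R]_(m.+1, p.+1)) :
  csmooth F -> csmooth G -> csmooth (fun y => F y + G y).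
Proof.
move=> Fs Gs i j; apply: (@eq_smooth _ _ (fun y => F y i j + G y i j)).
  by move=> y; rewrite mxE.
exact: smoothD.
Qed.

Lemma csmoothZ m p (g : V -> R^o) (F : V -> 'M[R]_(m.+1, p.+1)) :
  smooth g -> csmooth F -> csmooth (fun y => g y *: F y).
Proof.
move=> gs Fs i j; apply: (@eq_smooth _ _ (fun y => g y * F y i j)).
  by move=> y; rewrite mxE.
exact: smoothM.
Qed.

Lemma csmooth_tr m p (F : V -> 'M[R]_(m.+1, p.+1)) :
  csmooth F -> csmooth (fun y => (F y)^T).
Proof. by move=> Fs i j; apply: (eq_smooth _ (Fs j i)) => y; rewrite mxE. Qed.

Lemma csmooth_sum m p q (F : 'I_q -> V -> 'M[R]_(m.+1, p.+1)) :
  (forall k, csmooth (F k)) -> csmooth (fun y => \sum_k F k y).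
Proof.
move=> Fs i j; apply: (@eq_smooth _ _ (fun y => \sum_k F k y i j)).
  by move=> y; rewrite summxE.
by apply: smooth_sum => k; exact: Fs.
Qed.

Lemma smooth_omega (F G H : V -> 'cV[R]_7) : csmooth F -> csmooth G -> csmooth H ->
  smooth (fun y => omega_tilde (F y) (G y) (H y) : R^o).
Proof.
move=> Fs Gs Hs; apply: smooth_sum => k; apply: smoothM; last exact: Hs.
apply: (@eq_smooth _ _ (fun y =>
  \sum_i \sum_j F y i 0 * G y j 0 * (epsilon i.+1 j.+1 k.+1)%:~R)).
  by move=> y; rewrite cross_sum.
apply: smooth_sum => i; apply: smooth_sum => j; apply: smoothM; last exact: smooth_cst.
by apply: smoothM; [exact: Fs|exact: Gs].
Qed.

Lemma csmooth_eq_cst m p (F : V -> 'M[R]_(m.+1, p.+1)) : csmooth F ->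
  (forall y v, 'D_v F y = 0) -> forall y, F y = F 0.
Proof.
move=> Fs F0 y; apply/matrixP => i j.
have der z : derivable (fun y => F y i j : R^o) z y.
  exact/diff_derivable/smooth_diff/Fs.
have [s _] := MVT_line 0 ltr01 der.
rewrite scale1r add0r -csmooth_deriveE // F0 mxE mul0r => /eqP.
by rewrite subr_eq0 => /eqP.
Qed.

End EntrywiseSmooth.

(** * Stereographic charts *)

Section Stereo.
Context {R : realType}.
Local Notation V := 'cV[R]_6.
Implicit Types (y u v w : V) (s : bool).

Lemma smooth_coord n (i : 'I_n.+1) : smooth (fun y : 'cV[R]_n.+1 => y i 0 : R^o).
Proof.
have D (v : 'cV[R]_n.+1) :
    (fun z : 'cV[R]_n.+1 => 'D_v (fun y : 'cV[R]_n.+1 => y i 0 : R^o) z : R^o) =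
    fun _ => v i 0.
  apply/funext => y.
  have Di := (is_derive_mxP (fun y : 'cV[R]_n.+1 => y) y v v).1 (is_derive_id y v) i 0.
  exact: (@derive_val _ _ _ _ _ _ _ Di).
case=> [|k] /=.
  by move=> y; apply: differentiable_continuous; exact: differentiable_coord.
split=> [y|v]; first exact: differentiable_coord.
by rewrite D; exact: Ck_cst.
Qed.

Lemma smooth_dot m (F G : V -> 'cV[R]_m) : (forall i, smooth (fun y => F y i 0 : R^o)) ->
  (forall i, smooth (fun y => G y i 0 : R^o)) -> smooth (fun y => dot (F y) (G y) : R^o).
Proof. by move=> Fs Gs; apply: smooth_sum => i; apply: smoothM. Qed.

Lemma dot_col_mx m n (a c : 'cV[R]_m) (b d : 'cV[R]_n) :
  dot (col_mx a b) (col_mx c d) = dot a c + dot b d.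
Proof.
rewrite /dot big_split_ord; congr (_ + _); apply: eq_bigr => i _.
  by rewrite !col_mxEu.
by rewrite !col_mxEd.
Qed.

Lemma dot_scalar_mx (a b : R) : dot (a%:M : 'cV_1) (b%:M : 'cV_1) = a * b.
Proof. by rewrite /dot big_ord1 !mxE !mulr1n. Qed.

Definition stereo_den y : R := 1 + dot y y.

Lemma stereo_den_gt0 y : 0 < stereo_den y.
Proof. by rewrite ltr_pwDl ?ltr01 ?dot_ge0. Qed.

Lemma smooth_stereo_den : smooth (stereo_den : V -> R^o).
Proof.
apply: smoothD; first exact: smooth_cst.
by apply: smooth_dot => i; exact: smooth_coord.
Qed.

Lemma stereo_neq0 y : stereo_den y != 0.
Proof. by rewrite gt_eqF // stereo_den_gt0. Qed.

Lemma smooth_stereo s (i : 'I_7) : smooth (fun y => stereo s y i 0 : R^o).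
Proof.
have E : (fun y => stereo s y i 0 : R^o) =
    (fun y => (stereo_den y)^-1 * (col_mx (2 *: y)
      (((-1) ^+ s * (dot y y - 1))%:M : 'cV[R]_1) : 'cV[R]_(6 + 1)) i 0 : R^o).
  by apply/funext => y; rewrite /stereo mxE.
rewrite E; apply: smoothM.
  by apply: smoothV; [exact: stereo_neq0|exact: smooth_stereo_den].
have [k ->|k ->] := split_ordP (i : 'I_(6 + 1)).
  apply: (@eq_smooth _ _ (fun y : V => 2 * y k 0)) => [y|]; first by rewrite col_mxEu mxE.
  by apply: smoothM; [exact: smooth_cst|exact: smooth_coord].
apply: (@eq_smooth _ _ (fun y : V => (-1) ^+ s * (dot y y + -1))) => [y|].
  by rewrite col_mxEd (ord1 k) mxE mulr1n.
apply: smoothM; first exact: smooth_cst.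
apply: smoothD; last exact: smooth_cst.
by apply: smooth_dot => j; exact: smooth_coord.
Qed.

Lemma stereo_num_dot s y :
  let P : 'cV[R]_(6 + 1) := col_mx (2 *: y) ((-1) ^+ s * (dot y y - 1))%:M in
  dot P P = stereo_den y ^+ 2.
Proof.
rewrite /= dot_col_mx dot_scalar_mx dotZl dotZr /stereo_den.
have s2 : (-1) ^+ s * (-1) ^+ s = 1 :> R by rewrite -expr2 sqrr_sign.
by rewrite mulrACA s2 mul1r; ring.
Qed.

Lemma stereo_norm s y : dot (stereo s y) (stereo s y) = 1.
Proof.
rewrite /stereo dotZl dotZr stereo_num_dot /stereo_den; field.
exact: stereo_neq0.
Qed.

Definition stereo_num_D s y u : 'cV[R]_7 :=
  col_mx (2 *: u) ((-1) ^+ s * (2 * dot y u))%:M : 'cV[R]_(6 + 1).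

Definition stereo_D s y u : 'cV[R]_7 :=
  (stereo_den y)^-1 *: stereo_num_D s y u
  - (2 * dot y u * (stereo_den y)^-1) *: stereo s y.

Lemma is_derive_stereo s y u : is_derive y u (stereo s) (stereo_D s y u).
Proof.
have dd : is_derive y u (fun y : V => dot y y : R) (2 * dot y u).
  apply: (is_derive_conv (is_derive_dot (is_derive_id y u) (is_derive_id y u))) => //.
  by rewrite (dotC u); ring.
have dden : is_derive y u (fun y : V => stereo_den y : R) (2 * dot y u).
  apply: (is_derive_conv (is_deriveD (is_derive_cst (1 : R) y u) dd)) => //.
  by rewrite add0r.
have dinv : is_derive y u (fun y : V => (stereo_den y)^-1 : R)
    (- (2 * dot y u) * ((stereo_den y)^-1) ^+ 2).
  have dd' : derivable (fun y : V => stereo_den y : R) y u by case: dden.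
  split; first exact: (derivableV (stereo_neq0 y) dd').
  rewrite deriveV ?stereo_neq0 // (@derive_val _ _ _ _ _ _ _ dden).
  by rewrite /GRing.scale /= exprVn; ring.
apply/is_derive_mxP => i j; rewrite (ord1 j) {j}.
have dP : is_derive y u (fun y : V => (col_mx (2 *: y)
      (((-1) ^+ s * (dot y y - 1))%:M : 'cV[R]_1) : 'cV[R]_(6 + 1)) i 0 : R)
    ((col_mx (2 *: u) ((-1) ^+ s * (2 * dot y u))%:M : 'cV[R]_(6 + 1)) i 0).
  have [k ->|k ->] := split_ordP (i : 'I_(6 + 1)).
    have dk := (is_derive_mxP (fun y : V => y) y u u).1 (is_derive_id y u) k 0.
    apply: (is_derive_conv (is_derive_mul (is_derive_cst (2 : R) y u) dk)) => [z|].
      by rewrite col_mxEu mxE.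
    by rewrite col_mxEu mxE mul0r add0r.
  apply: (is_derive_conv (is_derive_mul (is_derive_cst ((-1) ^+ s : R) y u)
    (is_deriveB dd (is_derive_cst (1 : R) y u)))) => [z|].
    by rewrite col_mxEd (ord1 k) mxE mulr1n.
  by rewrite col_mxEd (ord1 k) mxE mulr1n mul0r add0r subr0.
apply: (is_derive_conv (is_derive_mul dinv dP)) => [z|].
  by rewrite /stereo [RHS]mxE.
rewrite /stereo_D /stereo_num_D /stereo -/(stereo_den _) !coordE /=; ring.
Qed.

Lemma derive_stereo s y u : 'D_u (stereo s) y = stereo_D s y u.
Proof. have D := is_derive_stereo s y u; exact: (@derive_val _ _ _ _ _ _ _ D). Qed.

Lemma stereo_D_tangent s y u : dot (stereo s y) (stereo_D s y u) = 0.
Proof.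
have D := is_derive_dot (is_derive_stereo s y u) (is_derive_stereo s y u).
have := @derive_val _ _ _ _ _ _ _ D.
rewrite (_ : (fun _ => _) = cst (1 : R)); last by apply/funext => z; exact: stereo_norm.
rewrite derive_cst (dotC (stereo_D s y u)); lra.
Qed.

Lemma stereo_conformal s y u v :
  dot (stereo_D s y u) (stereo_D s y v) = 4 * (stereo_den y)^-1 ^+ 2 * dot u v.
Proof.
have s2 : (-1) ^+ s * (-1) ^+ s = 1 :> R by rewrite -expr2 sqrr_sign.
have aa z w : dot (stereo_num_D s y z) (stereo_num_D s y w) =
    4 * dot z w + 4 * dot y z * dot y w.
  rewrite /stereo_num_D (@dot_col_mx 6 1) dot_scalar_mx dotZl dotZr mulrACA s2.
  by rewrite mul1r; ring.
have fa z : dot (stereo s y) (stereo_num_D s y z) = 2 * dot y z.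
  rewrite /stereo /stereo_num_D dotZl (@dot_col_mx 6 1) dot_scalar_mx dotZl dotZr.
  rewrite mulrACA s2 mul1r /stereo_den; field.
  exact: stereo_neq0.
have ff := stereo_norm s y; rewrite /stereo_D.
move: (stereo s y) fa ff => f fa ff.
rewrite !dotE aa (dotC (stereo_num_D s y u) f) !fa ff.
field; exact: stereo_neq0.
Qed.

(** The preimage of p is its first six coordinates divided by 1 - c, where c is
    the last coordinate measured towards the missing pole. *)
Lemma stereo_surj s (p : 'cV[R]_7) : dot p p = 1 ->
  (p : 'cV[R]_(6 + 1)) (rshift 6 ord0) 0 != (-1) ^+ s ->
  exists y, stereo s y = p.
Proof.
move=> pp ps; pose p' := usubmx (p : 'cV[R]_(6 + 1)).
pose c := (-1) ^+ s * (p : 'cV[R]_(6 + 1)) (rshift 6 ord0) 0.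
have s2 : (-1) ^+ s * (-1) ^+ s = 1 :> R by rewrite -expr2 sqrr_sign.
have c1 : 1 - c != 0.
  rewrite subr_eq0; apply: contra ps => /eqP E.
  have -> : (p : 'cV[R]_(6 + 1)) (rshift 6 ord0) 0 = (-1) ^+ s * c.
    by rewrite /c mulrA s2 mul1r.
  by rewrite -E mulr1.
have pE : p = col_mx p' (((-1) ^+ s * c)%:M : 'cV[R]_1) :> 'cV[R]_(6 + 1).
  apply: etrans (esym (@vsubmxK _ 6 1 1 p)) _; congr col_mx; apply/colP => i.
  by rewrite (ord1 i) !mxE mulr1n mulrA s2 mul1r.
have p'c : dot p' p' = 1 - c ^+ 2.
  have : dot (p : 'cV[R]_(6 + 1)) p = 1 by [].
  by rewrite {1 2}pE (@dot_col_mx 6 1) dot_scalar_mx mulrACA s2 mul1r => <-; ring.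
exists ((1 - c)^-1 *: p'); rewrite /stereo.
have -> : dot ((1 - c)^-1 *: p') ((1 - c)^-1 *: p') = (1 + c) / (1 - c).
  by rewrite dotZl dotZr p'c; field.
have -> : 1 + (1 + c) / (1 - c) = 2 / (1 - c) by field.
apply: etrans (esym pE); apply: etrans (scale_col_mx _ _ _) _; congr col_mx.
  by rewrite !scalerA (_ : _ * _ = 1) ?scale1r //; field.
rewrite scale_scalar_mx; congr (_%:M); field.
by [].
Qed.

End Stereo.

(** A 7 x 7 matrix B with B^T B = 1 also satisfies B B^T = 1; the columns of B are
    p and the vectors c g_k. *)
Lemma orthogonal_frame (R : realType) (p : 'cV[R]_7) (g : 'I_6 -> 'cV[R]_7) (c : R) :
  dot p p = 1 -> (forall k, dot p (g k) = 0) ->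
  (forall i k, c ^+ 2 * dot (g i) (g k) = (i == k)%:R) ->
  forall t, t = dot p t *: p + \sum_k (c ^+ 2 * dot (g k) t) *: g k.
Proof.
move=> pp pg gg t.
pose F : 'M[R]_(7, 6) := \matrix_(i, k) (c * g k i 0).
pose B : 'M[R]_(7, 1 + 6) := row_mx p F.
have dotM m (a b : 'cV[R]_m) i j : (a^T *m b) i j = dot a b.
  by rewrite mxE; apply: eq_bigr => l _; rewrite mxE (ord1 i) (ord1 j).
have FTt (a : 'cV[R]_7) k : (F^T *m a) k 0 = c * dot (g k) a.
  by rewrite /dot mulr_sumr mxE; apply: eq_bigr => l _; rewrite !mxE; ring.
have Fp : F^T *m p = 0.
  by apply/colP => k; rewrite FTt dotC pg mxE mulr0.
have BB : B^T *m B = 1%:M.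
  rewrite tr_row_mx mul_col_row; apply: etrans (esym (@scalar_mx_block R 1 6 1)).
  congr block_mx => //.
  - by apply/matrixP => i j; rewrite dotM pp (ord1 i) (ord1 j) mxE.
  - by have /(congr1 trmx) := Fp; rewrite trmx_mul trmxK trmx0.
  apply/matrixP => i k; rewrite [RHS]mxE -gg mxE /dot mulr_sumr.
  by apply: eq_bigr => l _; rewrite !mxE; ring.
have {}BB : B *m B^T = 1%:M := mulmx1C BB.
have {1}-> : t = (B *m B^T) *m t by rewrite BB mul1mx.
rewrite tr_row_mx mul_row_col mulmxDl -!mulmxA; congr (_ + _).
  rewrite (_ : p^T *m t = (dot p t)%:M) ?mul_mx_scalar //.
  by apply/matrixP => i j; rewrite dotM (ord1 i) (ord1 j) mxE.
apply/colP => i; rewrite mxE summxE; apply: eq_bigr => k _.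
by rewrite FTt !mxE; ring.
Qed.

Section Frame.
Context {R : realType} (s : bool).
Local Notation V := 'cV[R]_6.
Local Notation f := (@stereo R s).
Local Notation e k := (delta_mx k 0 : V).
Implicit Types (y u v w : V) (t : 'cV[R]_7).

Lemma csmooth_stereo : csmooth f.
Proof. by move=> i j; rewrite (ord1 j); exact: smooth_stereo. Qed.

Lemma stereo_tangent y u : dot (f y) ('D_u f y) = 0.
Proof. by rewrite derive_stereo stereo_D_tangent. Qed.

Lemma stereo_metric y u v :
  dot ('D_u f y) ('D_v f y) = 4 * (stereo_den y)^-1 ^+ 2 * dot u v.
Proof. by rewrite !derive_stereo stereo_conformal. Qed.

Lemma dot_deltas6 (i k : 'I_6) : dot (e i) (e k) = (i == k)%:R.
Proof. by rewrite dot_delta mxE eqxx andbT eq_sym. Qed.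

Definition inv_conformal_factor y : R := 4^-1 * stereo_den y ^+ 2.

Lemma stereo_frame y t : t = dot (f y) t *: f y +
  \sum_k (inv_conformal_factor y * dot ('D_(e k) f y) t) *: 'D_(e k) f y.
Proof.
have E : inv_conformal_factor y = (2^-1 * stereo_den y) ^+ 2.
  by rewrite /inv_conformal_factor; field.
rewrite E; apply: orthogonal_frame => [|k|i k].
- exact: stereo_norm.
- exact: stereo_tangent.
rewrite stereo_metric dot_deltas6.
case: (i == k); last by rewrite !mulr0.
by rewrite /=; field; exact: stereo_neq0.
Qed.

End Frame.

(** * Vector fields preserving omega in a chart *)

Section PsiVariation.
Context {R : realType}.
Implicit Types (A : 'M[R]_7) (f Y a b c d fz fu fv fw Yz Yu Yv Yw : 'cV[R]_7).

(** The variation of psi(f,fu,fv,fw) when its arguments move with velocities Y, Yu,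
    Yv, Yw. The last three terms are rotated cyclically so that the velocity always
    stands in the first two slots. *)
Definition psi_variation f Y fu fv fw Yu Yv Yw : R :=
  psi Y fu fv fw + psi f Yu fv fw + psi f Yv fw fu + psi f Yw fu fv.

(** The derivative of the previous expression in a direction z; fzu stands for the
    second derivative along z and u, and the second derivatives of f are kept in
    the third slot. *)
Definition psi_variation_D f Y fz fu fv fw Yz Yu Yv Yw fzu fzv fzw Yzu Yzv Yzw : R :=
  psi Yz fu fv fw + psi fz Yu fv fw + psi fz Yv fw fu + psi fz Yw fu fv
  + (psi Y fzu fv fw + psi Y fzv fw fu + psi Y fzw fu fv)
  + (psi f Yzu fv fw + psi f Yzv fw fu + psi f Yzw fu fv)
  + (psi f Yu fzv fw - psi f Yu fzw fv)
  + (psi f Yv fzw fu - psi f Yv fzu fw)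
  + (psi f Yw fzu fv - psi f Yw fzv fu).

Lemma lie_psi_variation A a b c d a' b' c' d' :
  A *m a = a' -> A *m b = b' -> A *m c = c' -> A *m d = d' ->
  lie_psi A a b c d = psi_variation a a' b c d b' c' d'.
Proof.
move=> <- <- <- <-; rewrite /lie_psi /psi_variation.
rewrite (psi_swap23 a b (A *m c)) (psi_swap34 a _ b d).
rewrite (psi_swap34 a b c) (psi_swap23 a b (A *m d)); ring.
Qed.

(** The algebra of an exterior derivative. In the alternating sum of the four
    hypotheses the terms with a second derivative cancel, and the first order terms
    add up to four times the conclusion. *)
Lemma psi_variation_alternate f Y fz fu fv fw Yz Yu Yv Yw
    fzu fzv fzw fuv fuw fvw fuz fvz fwz fvu fwu fwv
    Yzu Yzv Yzw Yuv Yuw Yvw Yuz Yvz Ywz Yvu Ywu Ywv :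
  fuz = fzu -> fvz = fzv -> fwz = fzw -> fvu = fuv -> fwu = fuw -> fwv = fvw ->
  Yuz = Yzu -> Yvz = Yzv -> Ywz = Yzw -> Yvu = Yuv -> Ywu = Yuw -> Ywv = Yvw ->
  psi_variation_D f Y fz fu fv fw Yz Yu Yv Yw fzu fzv fzw Yzu Yzv Yzw = 0 ->
  psi_variation_D f Y fu fz fv fw Yu Yz Yv Yw fuz fuv fuw Yuz Yuv Yuw = 0 ->
  psi_variation_D f Y fv fz fu fw Yv Yz Yu Yw fvz fvu fvw Yvz Yvu Yvw = 0 ->
  psi_variation_D f Y fw fz fu fv Yw Yz Yu Yv fwz fwu fwv Ywz Ywu Ywv = 0 ->
  psi_variation fz Yz fu fv fw Yu Yv Yw = 0.
Proof.
do 12!move=> ->; rewrite /psi_variation_D /psi_variation.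
(* Bring every term to one ordering: velocities first, then second derivatives,
   then fz, fu, fv, fw in this order. *)
rewrite ?(psi_swap12 fz) ?(psi_swap12 fu) ?(psi_swap12 fv) ?(psi_swap12 fw).
rewrite ?(psi_swap34 _ _ fu fz) ?(psi_swap34 _ _ fv fz) ?(psi_swap34 _ _ fw fz).
rewrite ?(psi_swap34 _ _ fv fu) ?(psi_swap34 _ _ fw fu) ?(psi_swap34 _ _ fw fv).
rewrite ?(psi_swap23 _ fu fz) ?(psi_swap23 _ fv fz) ?(psi_swap23 _ fw fz).
rewrite ?(psi_swap23 _ fv fu) ?(psi_swap23 _ fw fu) ?(psi_swap23 _ fw fv).
rewrite ?(psi_swap34 _ _ fu fz) ?(psi_swap34 _ _ fv fz) ?(psi_swap34 _ _ fw fz).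
rewrite ?(psi_swap34 _ _ fv fu) ?(psi_swap34 _ _ fw fu) ?(psi_swap34 _ _ fw fv).
lra.
Qed.
Lemma is_derive_psi_variation (V : normedModType R)
    (F Y Fu Fv Fw Yu Yv Yw : V -> 'cV[R]_7) (x z : V) fz Yz fzu fzv fzw Yzu Yzv Yzw :
  is_derive x z F fz -> is_derive x z Y Yz ->
  is_derive x z Fu fzu -> is_derive x z Fv fzv -> is_derive x z Fw fzw ->
  is_derive x z Yu Yzu -> is_derive x z Yv Yzv -> is_derive x z Yw Yzw ->
  is_derive x z
    (fun y => psi_variation (F y) (Y y) (Fu y) (Fv y) (Fw y) (Yu y) (Yv y) (Yw y) : R)
    (psi_variation_D (F x) (Y x) fz (Fu x) (Fv x) (Fw x) Yz (Yu x) (Yv x) (Yw x)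
       fzu fzv fzw Yzu Yzv Yzw).
Proof.
move=> dF dY du dv dw dYu dYv dYw.
apply: (is_derive_conv (is_deriveD (is_deriveD (is_deriveD
  (is_derive_psi dY du dv dw) (is_derive_psi dF dYu dv dw))
  (is_derive_psi dF dYv dw du)) (is_derive_psi dF dYw du dv))) => //.
move: (F x) (Y x) (Fu x) (Fv x) (Fw x) (Yu x) (Yv x) (Yw x) => f y fu fv fw yu yv yw.
rewrite /psi_variation_D (psi_swap34 f yu fv) (psi_swap34 f yv fw) (psi_swap34 f yw fu).
rewrite (psi_swap23 y fu fzv) (psi_swap34 y fzv fu).
rewrite (psi_swap34 y fu fv fzw) (psi_swap23 y fu fzw); ring.
Qed.

End PsiVariation.

Lemma omega_swap23 (R : realType) (x1 x2 x3 : 'cV[R]_7) :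
  omega_tilde x1 x2 x3 = - omega_tilde x1 x3 x2.
Proof. by rewrite 2!omega_cyc omega_swap -omega_cyc. Qed.

Lemma lie_omega_cyc_eq0 (R : realType) (A : 'M[R]_7) a b c a' b' c' :
  A *m a = a' -> A *m b = b' -> A *m c = c' ->
  omega_tilde a' b c + omega_tilde b' c a + omega_tilde c' a b = 0 ->
  lie_omega A a b c = 0.
Proof.
by move=> <- <- <-; rewrite /lie_omega (omega_cyc a (A *m b)) -(omega_cyc (A *m c)).
Qed.

(** The algebra of d d = 0 for the 2-form phi(Y, ., .) = d a: both the second
    derivatives of f and those of the coefficients of a cancel in the cyclic sum. *)
Lemma cyclic_cancel (R : realType)
    (Y fu fv fw Yu Yv Yw fuv fvu fvw fwv fwu fuw : 'cV[R]_7)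
    (auv avu avw awv awu auw : R) :
  fvu = fuv -> fwv = fvw -> fuw = fwu -> avu = auv -> awv = avw -> auw = awu ->
  omega_tilde Yw fu fv + omega_tilde Y fuw fv + omega_tilde Y fu fvw = auw - avw ->
  omega_tilde Yu fv fw + omega_tilde Y fvu fw + omega_tilde Y fv fwu = avu - awu ->
  omega_tilde Yv fw fu + omega_tilde Y fwv fu + omega_tilde Y fw fuv = awv - auv ->
  omega_tilde Yu fv fw + omega_tilde Yv fw fu + omega_tilde Yw fu fv = 0.
Proof.
move=> -> -> -> -> -> ->; rewrite (omega_swap23 Y fv fwu) (omega_swap23 Y fw fuv).
rewrite (omega_swap23 Y fu fvw); lra.
Qed.

Section Chart.
Context {R : realType} (s : bool).
Local Notation V := 'cV[R]_6.
Local Notation f := (@stereo R s).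
Local Notation e k := (delta_mx k 0 : V).
Implicit Types (y u v w z : V) (t : 'cV[R]_7).

Lemma tangent_derive y t : dot (f y) t = 0 -> exists u, t = 'D_u f y.
Proof.
move=> ft; exists (\col_k (inv_conformal_factor y * dot ('D_(e k) f y) t)).
rewrite (csmooth_derive_sum _ _ (csmooth_stereo s)) {1}(stereo_frame s y t) ft.
rewrite scale0r add0r; apply: eq_bigr => k _; congr (_ *: _).
by rewrite [RHS]mxE.
Qed.

Context (Y : V -> 'cV[R]_7) (Ys : csmooth Y).
Context (fY : forall y, dot (f y) (Y y) = 0).
Context (a : V -> V -> R) (a_smooth : forall u, smooth (fun y => a y u : R^o)).
Context (da : forall y u v,
  omega_tilde (Y y) ('D_u f y) ('D_v f y) = ext_d1 a y u v).

Let fs := csmooth_stereo (R := R) s.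
Let fD y v := csmooth_is_derive y v fs.
Let fDs u := csmooth_D u fs.
Let fDD y u v := csmooth_is_derive y v (fDs u).
Let YD y v := csmooth_is_derive y v Ys.
Let YDD y u v := csmooth_is_derive y v (csmooth_D u Ys).

Let dbeta y u v w :
  omega_tilde ('D_w Y y) ('D_u f y) ('D_v f y)
  + omega_tilde (Y y) ('D_w (fun z => 'D_u f z) y) ('D_v f y)
  + omega_tilde (Y y) ('D_u f y) ('D_w (fun z => 'D_v f z) y) =
  'D_w (fun z => 'D_u (fun z => a z v : R^o) z : R^o) y
  - 'D_w (fun z => 'D_v (fun z => a z u : R^o) z : R^o) y.
Proof.
have D := is_derive_omega (YD y w) (fDD y u w) (fDD y v w).
rewrite -(@derive_val _ _ _ _ _ _ _ D).
have -> : (fun y => omega_tilde (Y y) ('D_u f y) ('D_v f y)) =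
  (fun z => 'D_u (fun z => a z v : R^o) z) - (fun z => 'D_v (fun z => a z u : R^o) z).
  by apply/funext => z; rewrite da.
by rewrite deriveB //; apply/diff_derivable/smooth_diff/smooth_D.
Qed.

Lemma chart_closed y u v w :
  omega_tilde ('D_u Y y) ('D_v f y) ('D_w f y)
  + omega_tilde ('D_v Y y) ('D_w f y) ('D_u f y)
  + omega_tilde ('D_w Y y) ('D_u f y) ('D_v f y) = 0.
Proof.
exact: (cyclic_cancel (csmooth_derive_comm y v u fs) (csmooth_derive_comm y w v fs)
  (csmooth_derive_comm y u w fs) (derive_comm y v u (a_smooth w))
  (derive_comm y w v (a_smooth u)) (derive_comm y u w (a_smooth v))
  (dbeta y u v w) (dbeta y v w u) (dbeta y w u v)).
Qed.

(** The matrix sending f to Y and D_u f to D_u Y, written with the dual frame of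
    [stereo_frame]: the Jacobian at f y of the extension of Y to a homogeneous
    field of degree 1. *)
Definition frame_jacobian y : 'M[R]_7 :=
  Y y *m (f y)^T + \sum_k inv_conformal_factor y *: ('D_(e k) Y y *m ('D_(e k) f y)^T).

Lemma frame_jacobianE y t : frame_jacobian y *m t = dot (f y) t *: Y y +
  \sum_k (inv_conformal_factor y * dot ('D_(e k) f y) t) *: 'D_(e k) Y y.
Proof.
have outer (b c : 'cV[R]_7) : (b *m c^T) *m t = dot c t *: b.
  rewrite -mulmxA (_ : c^T *m t = (dot c t)%:M) ?mul_mx_scalar //.
  apply/matrixP => i j; rewrite (ord1 i) (ord1 j) !mxE.
  by apply: eq_bigr => l _; rewrite [in LHS]mxE.
rewrite mulmxDl outer mulmx_suml; congr (_ + _); apply: eq_bigr => k _.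
by rewrite -scalemxAl outer scalerA.
Qed.

Lemma frame_jacobian_position y : frame_jacobian y *m f y = Y y.
Proof.
rewrite frame_jacobianE stereo_norm scale1r big1 ?addr0 // => k _.
by rewrite dotC stereo_tangent mulr0 scale0r.
Qed.

Lemma frame_jacobian_tangent y u : frame_jacobian y *m 'D_u f y = 'D_u Y y.
Proof.
rewrite frame_jacobianE stereo_tangent scale0r add0r (csmooth_derive_sum y u Ys).
apply: eq_bigr => k _; congr (_ *: _).
rewrite stereo_metric dotC dot_delta /inv_conformal_factor.
by field; exact: stereo_neq0.
Qed.

Let fYD y u : dot (f y) ('D_u Y y) = - dot (Y y) ('D_u f y).
Proof.
have D := is_derive_dot (fD y u) (YD y u).
have := @derive_val _ _ _ _ _ _ _ D.
rewrite (_ : (fun _ => _) = cst (0 : R)); last by apply/funext => z; exact: fY.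
rewrite derive_cst (dotC ('D_u f y) (Y y)) => /eqP.
by rewrite eq_sym addrC addr_eq0 => /eqP.
Qed.

Lemma frame_jacobian_lie_psi_position y u v w :
  lie_psi (frame_jacobian y) (f y) ('D_u f y) ('D_v f y) ('D_w f y) = 0.
Proof.
apply: (lie_psi_of_lie_omega (stereo_norm s y) (fY y) (frame_jacobian_position y));
  try exact: stereo_tangent.
- by move=> t /tangent_derive[u' ->]; rewrite frame_jacobian_tangent fYD.
move=> _ _ _ /tangent_derive[u' ->] /tangent_derive[v' ->] /tangent_derive[w' ->].
exact: (lie_omega_cyc_eq0 (frame_jacobian_tangent y u') (frame_jacobian_tangent y v')
  (frame_jacobian_tangent y w') (chart_closed y u' v' w')).
Qed.

Let variation0 y u v w : psi_variation (f y) (Y y) ('D_u f y) ('D_v f y) ('D_w f y)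
  ('D_u Y y) ('D_v Y y) ('D_w Y y) = 0.
Proof.
have E := lie_psi_variation (frame_jacobian_position y) (frame_jacobian_tangent y u)
  (frame_jacobian_tangent y v) (frame_jacobian_tangent y w).
apply: etrans (esym E) _; exact: frame_jacobian_lie_psi_position.
Qed.

Let dvariation0 y z u v w : psi_variation_D (f y) (Y y)
  ('D_z f y) ('D_u f y) ('D_v f y) ('D_w f y)
  ('D_z Y y) ('D_u Y y) ('D_v Y y) ('D_w Y y)
  ('D_z (fun y => 'D_u f y) y) ('D_z (fun y => 'D_v f y) y) ('D_z (fun y => 'D_w f y) y)
  ('D_z (fun y => 'D_u Y y) y) ('D_z (fun y => 'D_v Y y) y) ('D_z (fun y => 'D_w Y y) y)
  = 0.
Proof.
have D := is_derive_psi_variation (fD y z) (YD y z) (fDD y u z) (fDD y v z) (fDD y w z)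
  (YDD y u z) (YDD y v z) (YDD y w z).
apply: etrans (esym (@derive_val _ _ _ _ _ _ _ D)) _.
rewrite (_ : (fun _ => _) = cst (0 : R)) ?derive_cst //.
by apply/funext => x; exact: variation0.
Qed.

(** The relation of [frame_jacobian_lie_psi_position] holds at every y; this is its
    exterior derivative. *)
Lemma frame_jacobian_lie_psi_tangent y z u v w :
  lie_psi (frame_jacobian y) ('D_z f y) ('D_u f y) ('D_v f y) ('D_w f y) = 0.
Proof.
have E := lie_psi_variation (frame_jacobian_tangent y z) (frame_jacobian_tangent y u)
  (frame_jacobian_tangent y v) (frame_jacobian_tangent y w).
apply: etrans E _.
have fC u' v' := csmooth_derive_comm y u' v' fs.
have YC u' v' := csmooth_derive_comm y u' v' Ys.
exact: (psi_variation_alternate (fC z u) (fC z v) (fC z w) (fC u v) (fC u w) (fC v w)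
  (YC z u) (YC z v) (YC z w) (YC u v) (YC u w) (YC v w)
  (dvariation0 y z u v w) (dvariation0 y u z v w)
  (dvariation0 y v z u w) (dvariation0 y w z u v)).
Qed.

Lemma frame_jacobian_lie_psi y b1 b2 b3 b4 : lie_psi (frame_jacobian y) b1 b2 b3 b4 = 0.
Proof.
apply: (lie_psi_frame (stereo_norm s y)).
  move=> _ _ _ /tangent_derive[u ->] /tangent_derive[v ->] /tangent_derive[w ->].
  exact: frame_jacobian_lie_psi_position.
move=> _ _ _ _ /tangent_derive[z ->] /tangent_derive[u ->] /tangent_derive[v ->]
  /tangent_derive[w ->].
exact: frame_jacobian_lie_psi_tangent.
Qed.

Lemma smooth_inv_conformal_factor : smooth (@inv_conformal_factor R : V -> R^o).
Proof.
apply: smoothM; first exact: smooth_cst.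
by apply: smoothM; exact: smooth_stereo_den.
Qed.

Lemma csmooth_frame_jacobian : csmooth frame_jacobian.
Proof.
apply: csmoothD; first exact: csmooth_mulmx Ys (csmooth_tr fs).
apply: csmooth_sum => k; apply: csmoothZ; first exact: smooth_inv_conformal_factor.
by apply: csmooth_mulmx; [exact: csmooth_D|exact/csmooth_tr/csmooth_D].
Qed.

Let GD y v := csmooth_is_derive y v csmooth_frame_jacobian.

Lemma frame_jacobian_skew y b c :
  dot (frame_jacobian y *m b) c = - dot b (frame_jacobian y *m c).
Proof. exact: stab_skew (frame_jacobian_lie_psi y) b c. Qed.

Let d_frame_jacobian_skew y v b c :
  dot ('D_v frame_jacobian y *m b) c = - dot b ('D_v frame_jacobian y *m c).
Proof.
have D b' := is_derive_mulmx (GD y v) (is_derive_cst (b' : 'cV[R]_7) y v).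
have D2 := is_deriveD (is_derive_dot (D b) (is_derive_cst (c : 'cV[R]_7) y v))
  (is_derive_dot (is_derive_cst (b : 'cV[R]_7) y v) (D c)).
have dot0 m (d : 'cV[R]_m) : dot d 0 = 0 by rewrite -(scale0r 0) dotZr mul0r.
have := @derive_val _ _ _ _ _ _ _ D2.
rewrite (_ : _ + _ = cst (0 : R)) ?derive_cst; last first.
  apply/funext => x.
  rewrite -[LHS]/(dot (frame_jacobian x *m b) c + dot b (frame_jacobian x *m c)).
  by rewrite frame_jacobian_skew addNr.
rewrite !mulmx0 !addr0 (dotC 0) !dot0 addr0 add0r => /esym/eqP.
by rewrite addr_eq0 => /eqP.
Qed.

Let d_frame_jacobian_position y v : 'D_v frame_jacobian y *m f y = 0.
Proof.
have D := is_derive_mulmx (GD y v) (fD y v).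
have E : (fun y => frame_jacobian y *m f y) = Y.
  by apply/funext => x; exact: frame_jacobian_position.
rewrite E in D; have := @derive_val _ _ _ _ _ _ _ D.
by rewrite frame_jacobian_tangent => /eqP; rewrite eq_sym -subr_eq0 addrK => /eqP.
Qed.

Let d_frame_jacobian_sym y u v :
  'D_v frame_jacobian y *m 'D_u f y = 'D_u frame_jacobian y *m 'D_v f y.
Proof.
have H u' v' : 'D_v' frame_jacobian y *m 'D_u' f y =
    'D_v' (fun y => 'D_u' Y y) y - frame_jacobian y *m 'D_v' (fun y => 'D_u' f y) y.
  have D := is_derive_mulmx (GD y v') (fDD y u' v').
  have E : (fun y => frame_jacobian y *m 'D_u' f y) = (fun y => 'D_u' Y y).
    by apply/funext => x; exact: frame_jacobian_tangent.
  rewrite E in D; have -> := @derive_val _ _ _ _ _ _ _ D.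
  by rewrite addrK.
apply: (etrans (H u v)); apply: (etrans _ (esym (H v u))).
exact: (congr2 (fun b c => b - frame_jacobian y *m c) (csmooth_derive_comm y u v Ys)
  (csmooth_derive_comm y u v fs)).
Qed.

(** <(D_v A) D_u f, D_w f> is symmetric in u and v because A D_u f = D_u Y, and skew
    in u and w because A is skew; such a trilinear form vanishes. *)
Lemma d_frame_jacobian0 y v : 'D_v frame_jacobian y = 0.
Proof.
pose S v u w := dot ('D_v frame_jacobian y *m 'D_u f y) ('D_w f y).
have Ssym v' u' w' : S v' u' w' = S u' v' w'.
  exact: (congr1 (fun b => dot b ('D_w' f y)) (d_frame_jacobian_sym y u' v')).
have Sskew v' u' w' : S v' u' w' = - S v' w' u'.
  by apply: etrans (d_frame_jacobian_skew y v' _ _) _; congr (- _); exact: dotC.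
have S0 v' u' w' : S v' u' w' = 0.
  have E1 := Ssym v' u' w'; have E2 := Sskew u' v' w'; have E3 := Ssym u' w' v'.
  have E4 := Sskew w' u' v'; have E5 := Ssym w' v' u'; have E6 := Sskew v' w' u'.
  move: (S v' u' w') (S u' v' w') (S v' w' u') (S u' w' v') (S w' u' v') (S w' v' u')
    E1 E2 E3 E4 E5 E6 => *; lra.
have Bt t : exists u, 'D_v frame_jacobian y *m t = 'D_v frame_jacobian y *m 'D_u f y /\
    t = dot (f y) t *: f y + 'D_u f y.
  have [|u E] := @tangent_derive y (t - dot (f y) t *: f y).
    by rewrite dotDr dotNr dotZr stereo_norm mulr1 subrr.
  have tE : t = dot (f y) t *: f y + 'D_u f y by rewrite -E addrC subrK.
  exists u; split=> //; rewrite {1}tE mulmxDr -scalemxAr d_frame_jacobian_position.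
  by rewrite scaler0 add0r.
have B0 t : 'D_v frame_jacobian y *m t = 0.
  apply: dot_inj => t'; have [u [-> _]] := Bt t; have [w [_ ->]] := Bt t'.
  rewrite dotDr dotZr d_frame_jacobian_skew d_frame_jacobian_position.
  rewrite (_ : dot _ 0 = 0) ?oppr0 ?mulr0 ?add0r; last first.
    by rewrite -(scale0r 0) dotZr mul0r.
  rewrite (_ : dot 0 _ = 0); last by rewrite -(scale0r 0) dotZl mul0r.
  exact: S0.
apply/matrixP => i j; have /colP/(_ i) := B0 (delta_mx j 0).
by rewrite -colE !mxE.
Qed.

Lemma chart_linear : exists A : 'M[R]_7,
  (forall b1 b2 b3 b4, lie_psi A b1 b2 b3 b4 = 0) /\ forall y, Y y = A *m f y.
Proof.
exists (frame_jacobian 0); split=> [|y]; first exact: frame_jacobian_lie_psi.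
rewrite -(csmooth_eq_cst csmooth_frame_jacobian d_frame_jacobian0 y).
by rewrite frame_jacobian_position.
Qed.

End Chart.

(** * Solutions of the HDW equation on the sphere *)

Section HDW.
Context {R : realType}.
Local Notation V := 'cV[R]_6.
Implicit Types (X : 'cV[R]_7 -> 'cV[R]_7) (xi A : 'M[R]_7) (p t : 'cV[R]_7).

Lemma vector_field_csmooth X s : is_vector_field X ->
  csmooth (fun y : V => X (stereo s y)).
Proof.
move=> [_ /(_ s)[xi [xis XE]]] i j.
apply: (@eq_smooth _ _
  (fun y : V => (\sum_k xi y k 0 *: 'D_(delta_mx k 0) (stereo s) y) i j)) => [y|].
  by rewrite XE (csmooth_derive_sum _ _ (csmooth_stereo s)).
apply: csmooth_sum => k; apply: csmoothZ; last exact/csmooth_D/csmooth_stereo.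
exact: smooth_csmooth.
Qed.

Lemma HDW_chart_linear X s : is_vector_field X -> solves_HDW X ->
  exists A, (forall a b c d, lie_psi A a b c d = 0) /\
    forall y, X (stereo s y) = A *m stereo s y.
Proof.
move=> hX [a [[_ a_smooth] da]].
apply: (@chart_linear R s (fun y => X (stereo s y)) _ _ (pullback1 (stereo s) a)).
- exact: vector_field_csmooth.
- by move=> y; apply: hX.1; exact: stereo_norm.
- by move=> u; exact: a_smooth.
- by move=> y u v; exact: da.
Qed.

(** The matrices of the two charts agree on the points of the sphere other than
    the poles, and these span R^7. *)
Lemma HDW_linear X : is_vector_field X -> solves_HDW X ->
  exists A, (forall a b c d, lie_psi A a b c d = 0) /\
    forall p, sphere6 p -> X p = A *m p.
Proof.
move=> hX HX; have neq1N1 : (1 : R) != -1 by rewrite gt_eqF //; lra.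
have [A [Apsi AX]] := HDW_chart_linear false hX HX.
have [B [_ BX]] := HDW_chart_linear true hX HX.
pose last7 p : R := (p : 'cV[R]_(6 + 1)) (rshift 6 ord0) 0.
have XA p : dot p p = 1 -> last7 p != 1 -> X p = A *m p.
  by move=> pp pl; have [y <-] := @stereo_surj R false p pp pl; exact: AX.
have XB p : dot p p = 1 -> last7 p != -1 -> X p = B *m p.
  by move=> pp pl; have [y <-] := @stereo_surj R true p pp pl; exact: BX.
have AB p : dot p p = 1 -> last7 p != 1 -> last7 p != -1 -> A *m p = B *m p.
  by move=> pp l1 l2; rewrite -XA // XB.
pose e i : 'cV[R]_7 := delta_mx i 0.
have ee i j : dot (e i) (e j) = (i == j)%:R by exact: dot_deltas.
pose i6 : 'I_7 := @Ordinal 7 6 isT.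
have last7E p : last7 p = p i6 0 by congr (p _ _); apply: val_inj.
have ABe i : A *m e i = B *m e i.
  have small j : j != i6 -> A *m e j = B *m e j.
    move=> j6; have l0 : last7 (e j) = 0.
      by rewrite last7E mxE eq_sym (negPf j6).
    by apply: AB; rewrite ?ee ?eqxx // l0 eq_sym ?oppr_eq0 oner_eq0.
  have [->|] := eqVneq i i6; last exact: small.
  (* A unit vector other than the pole, rational in order to avoid square roots. *)
  pose q : 'cV[R]_7 := (3 / 5) *: e ord0 + (4 / 5) *: e i6.
  have lq : last7 q = 4 / 5 by rewrite last7E !mxE /= mulr0 add0r mulr1.
  have : A *m q = B *m q.
    apply: AB.
    - by rewrite /q !dotE !ee /=; field.
    - by rewrite lq; lra.
    - by rewrite lq; lra.
  rewrite /q !mulmxDr -!scalemxAr (small ord0) // => /addrI.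
  apply: scalerI; lra.
have {ABe}AB' : A = B.
  apply/matrixP => i j; have /colP/(_ i) := ABe j.
  by rewrite -!colE !mxE.
exists A; split=> // p pp.
have [l1|] := eqVneq (last7 p) 1; last exact: XA.
by rewrite AB'; apply: XB => //; rewrite l1.
Qed.

(** d (i_X sigma) = - 3 i_X omega in terms of the values and derivatives of a chart f,
    for the field X(p) = A p. *)
Lemma ext_d_cancel (A : 'M[R]_7) (f fu fv fuv fvu : 'cV[R]_7) :
  fuv = fvu -> lie_omega A f fu fv = 0 ->
  omega_tilde (A *m f) fu fv =
  - 3^-1 * (omega_tilde fu (A *m f) fv + omega_tilde f (A *m fu) fv
            + omega_tilde f (A *m f) fvu)
  - - 3^-1 * (omega_tilde fv (A *m f) fu + omega_tilde f (A *m fv) fu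
              + omega_tilde f (A *m f) fuv).
Proof.
move=> ->; rewrite /lie_omega (omega_swap fu) (omega_cyc fv).
rewrite (omega_swap23 f (A *m fv)); lra.
Qed.

Lemma fundamental_solves_HDW X xi : g2 xi ->
  (forall p, sphere6 p -> X p = fundamental_field xi p) -> solves_HDW X.
Proof.
move=> gxi Xxi; have xi0 := g2_lie_omega gxi.
exists (fun p t => - 3^-1 * omega_tilde p (xi *m p) t); split; first split.
- move=> p _ c u v _ _; rewrite /omega_tilde !bilinE; ring.
- move=> s u; apply: smoothM; first exact: smooth_cst.
  apply: smooth_omega; first exact: csmooth_stereo.
    by apply: csmooth_mulmx; [exact: csmooth_cst|exact: csmooth_stereo].
  exact/csmooth_D/csmooth_stereo.
move=> s y u v.
rewrite -[LHS]/(omega_tilde (X (stereo s y))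
  ('D_u (stereo s) y) ('D_v (stereo s) y)).
rewrite Xxi; last exact: stereo_norm.
rewrite fundamental_fieldE /ext_d1.
have fs := csmooth_stereo (R := R) s.
have D u' v' : 'D_u' (fun z => pullback1 (stereo s)
    (fun p t => - 3^-1 * omega_tilde p (xi *m p) t) z v' : R^o) y =
    - 3^-1 * (omega_tilde ('D_u' (stereo s) y) (xi *m stereo s y) ('D_v' (stereo s) y)
     + omega_tilde (stereo s y) (xi *m 'D_u' (stereo s) y) ('D_v' (stereo s) y)
     + omega_tilde (stereo s y) (xi *m stereo s y)
         ('D_u' (fun z => 'D_v' (stereo s) z) y)).
  have d1 := csmooth_is_derive y u' fs.
  have d2 := is_derive_mulmx (is_derive_cst xi y u') d1.
  have d3 := csmooth_is_derive y u' (csmooth_D v' fs).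
  have d4 := is_derive_mul (is_derive_cst (- 3^-1 : R) y u') (is_derive_omega d1 d2 d3).
  apply: etrans (@derive_val _ _ _ _ _ _ _ d4) _.
  by rewrite mul0mx add0r mul0r add0r.
have E := ext_d_cancel (csmooth_derive_comm y u v fs)
  (xi0 (stereo s y) ('D_u (stereo s) y) ('D_v (stereo s) y)).
apply: etrans E _.
exact: (esym (congr2 (fun b c : R => b - c) (D u v) (D v u))).
Qed.

End HDW.

Theorem proposition4p3 (R : realType) (X : 'cV[R]_7 -> 'cV[R]_7)
    (hX : is_vector_field X) :
  solves_HDW X <->
  exists xi : 'M[R]_7, g2 xi /\
    forall p : 'cV[R]_7, sphere6 p -> X p = fundamental_field xi p.
Proof.
split=> [HX|[xi [gxi Xxi]]]; last exact: fundamental_solves_HDW gxi Xxi.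
have [A [Apsi AX]] := HDW_linear hX HX; exists A; split.
  exact: lie_omega_g2 (stab_skew Apsi) (stab_omega Apsi).
by move=> p pp; rewrite fundamental_fieldE AX.
Qed.
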